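(* Let $f:\mathbb{R}\times\mathbb{R}^2\to\mathbb{R}^2$ be a sufficiently smooth vector field with $\operatorname{div}_x f(t,\cdot)\equiv 0$ for all $t$, let $\phi(s,t)$ denote the flow of $\dot{x}(t)=f(t,x(t))$, let $T>0$, $\varepsilon>0$, and fix a trajectory $x(t)=\phi(0,t)x(0)$, $t\in[0,T]$. Let $W(0,t)\in\mathbb{R}^{2\times 2}$ be the fundamental matrix along this trajectory, and let $\sigma(t)$ be the larger of the two singular values of $W(0,t)$. Assume that: (i) the right singular vector of $W(0,t)$ corresponding to $\sigma(t)$ is independent of $t$, i.e., there is a fixed unit vector $v\in\mathbb{R}^2$ which is a right singular vector of $W(0,t)$ for the singular value $\sigma(t)$ for every $t\in[0,T]$; (ii) the largest stretching appears at final time, i.e., $\sigma(T)=\max_{t\in[0,T]}\sigma(t)$. Let $$\mathbb{S}(0,T)=\bigcup_{t\in[0,T]}W(0,t)^{-1}\,\mathbb{B}_{\varepsilon}(0).$$ Then $$\operatorname{vol}(\mathbb{S}(0,T))=\bigl(\pi+2\log(\sigma(T))\bigr)\,\varepsilon^2 .$$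
   Context: The vector field $f$ is smooth enough that solutions of $\dot{x}(t)=f(t,x(t))$ exist, are unique, and depend differentiably on the initial condition. The flow $\phi(s,t)$ maps a state at time $s$ to the state at time $t$: $x(t)=\phi(s,t)x(s)$ for every solution $x$. The fundamental matrix (Wronskian matrix) along the trajectory is $W(s,t)=D_x(\phi(s,t)x)$ evaluated at $x=x(s)$, where $D_x$ is the derivative with respect to $x$; equivalently, it is the solution of $\dot{W}(s,t)=D_xf(t,x(t))\,W(s,t)$, $W(s,s)=I$, where the dot denotes the derivative with respect to $t$. The set $\mathbb{B}_{\varepsilon}(0)\subset\mathbb{R}^2$ is the closed Euclidean ball of radius $\varepsilon$ centered at the origin, $\operatorname{vol}$ denotes two-dimensional Lebesgue measure, and $\log$ is the natural logarithm. A right singular vector of a matrix $W$ for the singular value $\sigma$ is a unit vector $v$ with $W^{T}Wv=\sigma^2 v$. *)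

(* Defs.v *)
From HB Require Import structures.
From mathcomp Require Import all_boot all_order all_algebra.
From mathcomp Require Import all_classical all_reals all_analysis.
Import Order.TTheory GRing.Theory Num.Theory.
Import numFieldNormedType.Exports.

Set Implicit Arguments.
Unset Strict Implicit.
Unset Printing Implicit Defensive.

Local Open Scope classical_set_scope.
Local Open Scope ring_scope.

(* States are column vectors, so that matrices act on them from the left. The
   library norm on ['cV[R]_2] is the sup norm; it is used only for topology and
   differentiation, and [enorm] is the Euclidean norm. *)
Definition enorm (R : realType) (u : 'cV[R]_2) : R :=
  Num.sqrt (\sum_i u i 0 ^+ 2).

Definition eball (R : realType) (eps : R) : set 'cV[R]_2 :=
  [set u | enorm u <= eps].

(* The set is pulled back along the coordinate isomorphism R x R -> R^2, and
   measured with the product of the one-dimensional Lebesgue measures. *)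
Definition vol (R : realType) (A : set 'cV[R]_2) : \bar R :=
  (lebesgue_measure \x lebesgue_measure)%E
    [set p : measurableTypeR R * measurableTypeR R |
      A (\col_(i < 2) (if i == 0 then p.1 else p.2))].

(* Entry (i, j) is the partial derivative of the i-th component of F in the j-th
   variable: the transpose of the library's [jacobian], which is for row
   vectors. *)
Definition jac (R : realType) (F : 'cV[R]_2 -> 'cV[R]_2) (p : 'cV[R]_2) :
    'M[R]_2 :=
  \matrix_(i, j) ('D_(delta_mx j 0) F p) i 0.

Definition divergence (R : realType) (F : 'cV[R]_2 -> 'cV[R]_2)
    (p : 'cV[R]_2) : R :=
  \sum_i ('D_(delta_mx i 0) F p) i 0.

Definition smooth_field (R : realType) (f : R -> 'cV[R]_2 -> 'cV[R]_2) : Prop :=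
  [/\ continuous (fun q : R * 'cV[R]_2 => f q.1 q.2),
      forall t p, differentiable (f t) p
    & continuous (fun q : R * 'cV[R]_2 => jac (f q.1) q.2)].

(* Since f is continuous, this forces the one-sided derivatives at a and b to
   satisfy the equation too (when a < b). If a = b the condition is void. *)
Definition solution (R : realType) (f : R -> 'cV[R]_2 -> 'cV[R]_2) (a b : R)
    (x : R -> 'cV[R]_2) : Prop :=
  {within `[a, b], continuous x} /\
  (forall t, a < t < b -> is_derive t 1 x (f t (x t))).

Definition solution_between (R : realType) (f : R -> 'cV[R]_2 -> 'cV[R]_2)
    (s t : R) (x : R -> 'cV[R]_2) : Prop :=
  solution f (Num.min s t) (Num.max s t) x.

(* The states at time s whose solution exists up to time t (t < s allowed).
   Completeness of the vector field is not assumed. *)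
Definition flow_domain (R : realType) (f : R -> 'cV[R]_2 -> 'cV[R]_2)
    (s t : R) : set 'cV[R]_2 :=
  [set p | exists2 x, solution_between f s t x & x s = p].

(* [phi s t] is meaningful on [flow_domain f s t] only. The clauses say that
   solutions exist locally, that they are unique and transported by phi, and
   that they depend differentiably on the initial condition; the last includes
   that solutions from nearby initial conditions exist up to the same time. *)
Definition is_flow (R : realType) (f : R -> 'cV[R]_2 -> 'cV[R]_2)
    (phi : R -> R -> 'cV[R]_2 -> 'cV[R]_2) : Prop :=
  [/\ forall s p, \forall t \near s, flow_domain f s t p,
      forall s t x, solution_between f s t x -> x t = phi s t (x s)
    & forall s t p, flow_domain f s t p ->
        (flow_domain f s t)° p /\ differentiable (phi s t) p].

Definition fundamental_matrix (R : realType)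
    (phi : R -> R -> 'cV[R]_2 -> 'cV[R]_2) (x : R -> 'cV[R]_2) (s t : R) :
    'M[R]_2 :=
  jac (phi s t) (x s).

Definition singular_value (R : realType) (A : 'M[R]_2) (s : R) : Prop :=
  0 <= s /\ eigenvalue (A^T *m A) (s ^+ 2).

Definition largest_singular_value (R : realType) (A : 'M[R]_2) (s : R) : Prop :=
  singular_value A s /\ (forall s', singular_value A s' -> s' <= s).

Definition right_singular_vector (R : realType) (A : 'M[R]_2) (s : R)
    (v : 'cV[R]_2) : Prop :=
  enorm v = 1 /\ A^T *m A *m v = s ^+ 2 *: v.

Definition stretched_union (R : realType) (W : R -> 'M[R]_2) (T eps : R) :
    set 'cV[R]_2 :=
  \bigcup_(t in `[0, T]) [set invmx (W t) *m u | u in eball eps].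

(* Main.v *)
Require Import Defs.
From mathcomp Require Import all_boot all_order all_algebra.
From mathcomp Require Import all_classical all_reals all_analysis.
From mathcomp Require Import measurable_realfun.
From mathcomp Require Import ring lra.
Import Order.TTheory GRing.Theory Num.Theory.
Import numFieldNormedType.Exports.

(** Difference quotients of solutions started near [x 0] stay bounded, by a
    Gronwall argument carried out as long as the perturbed solution remains in
    a tube around the trajectory. They satisfy the variational equation up to
    an error which tends to 0 uniformly on [0, T]; since the divergence
    vanishes, the determinant of two of them is almost constant. Passing to the
    limit, the entries of [W t] are Lipschitz in [t] and [\det (W t) = 1].

    Hence [sigma] is continuous with [sigma 0 = 1], and takes all values in
    [1, sigma T]. In the orthonormal basis made of [v] and its quarter turn, the
    preimage of the ball by [W t] is the ellipse
    [s^2 a^2 + b^2 / s^2 <= eps^2] with [s = sigma t]. The union of these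
    ellipses over [1 <= s <= sigma T] consists of two opposite sectors of the
    disc, two opposite sectors of the longest ellipse, and four regions bounded
    by the hyperbolas [2 |a b| = eps^2]; the latter produce the logarithm. *)

Set Implicit Arguments.
Unset Strict Implicit.
Unset Printing Implicit Defensive.

Local Open Scope classical_set_scope.
Local Open Scope ring_scope.

(** * Invariance of the area under SL2 *)

Lemma measurable_addr (R : realType) (c : R) :
  measurable_fun [set: measurableTypeR R] (fun x => x + c : measurableTypeR R).
Proof. by apply: measurable_funD => //; exact: measurable_cst. Qed.

(** The pushforward under the translation agrees with the Lebesgue measure on the intervals []a,
    b]], which determine it. *)
Lemma lebesgue_measure_translate (R : realType) (c : R)
    (A : set (measurableTypeR R)) : measurable A ->
  lebesgue_measure [set x | A (x + c)] = lebesgue_measure A.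
Proof.
move=> mA; pose f (x : measurableTypeR R) : measurableTypeR R := x + c.
have mf : measurable_fun [set: measurableTypeR R] f := measurable_addr c.
transitivity (pushforward lebesgue_measure f A); first by [].
apply/esym/lebesgue_measure_unique => // _ [[a b] _ <-].
rewrite /= /pushforward.
have -> : (f @^-1` `]a, b]) = `]a - c, b - c]%classic.
  by apply/seteqP; split => x /=; rewrite /f/= !in_itv/= ltrBlDr lerBrDr.
rewrite !lebesgue_measure_itv/= !lte_fin ltrD2r.
by case: ifP => // _; rewrite -!EFinB; congr (_%:E); ring.
Qed.

Section area.
Context {R : realType}.
Notation mR := (measurableTypeR R).
Notation area := ((@lebesgue_measure R) \x (@lebesgue_measure R))%E.

(** Both product measures agree on rectangles. This allows slicing along either coordinate. *)
Lemma product_lebesgue_measureC (A : set (mR * mR)) : measurable A ->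
  area A = (lebesgue_measure \x^ lebesgue_measure)%E A.
Proof. by apply: product_measure_unique => X Y mX mY;
  exact: product_measure2E. Qed.

Lemma measurable_linear_form (a b : R) :
  measurable_fun [set: mR * mR] (fun p => a * p.1 + b * p.2 : mR).
Proof.
by apply: measurable_funD; apply: measurable_funM => //;
  exact: measurable_cst.
Qed.

Lemma measurable_linear_map (a b c d : R) : measurable_fun [set: mR * mR]
  (fun p => (a * p.1 + b * p.2, c * p.1 + d * p.2) : mR * mR).
Proof. by apply: measurable_fun_pair; exact: measurable_linear_form. Qed.

Lemma measurable_linear_preimage (a b c d : R) (A : set (mR * mR)) :
  measurable A ->
  measurable [set p : mR * mR | A (a * p.1 + b * p.2, c * p.1 + d * p.2)].
Proof.
move=> mA; rewrite -[X in measurable X]setTI.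
exact: (measurable_linear_map a b c d).
Qed.

Lemma measurable_shear_fst (c : R) (A : set (mR * mR)) : measurable A ->
  measurable [set p : mR * mR | A (p.1 + c * p.2, p.2)].
Proof.
move=> /(measurable_linear_preimage 1 c 0 1).
by under eq_set do rewrite !mul1r mul0r add0r.
Qed.

Lemma measurable_shear_snd (c : R) (A : set (mR * mR)) : measurable A ->
  measurable [set p : mR * mR | A (p.1, c * p.1 + p.2)].
Proof.
move=> /(measurable_linear_preimage 1 0 c 1).
by under eq_set do rewrite !mul1r mul0r addr0.
Qed.

(** A shear translates each section at first coordinate [x] by [c * x], which preserves its
    length. *)
Lemma area_shear_snd (c : R) (A : set (mR * mR)) : measurable A ->
  area [set p : mR * mR | A (p.1, c * p.1 + p.2)] = area A.
Proof.
move=> mA; apply: eq_integral => x _ /=.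
rewrite -[RHS](lebesgue_measure_translate (c * x));
  last exact: measurable_xsection.
congr (lebesgue_measure _); apply/seteqP.
by split => y /=; rewrite /xsection/= !inE/= addrC.
Qed.

Lemma area_shear_fst (c : R) (A : set (mR * mR)) : measurable A ->
  area [set p : mR * mR | A (p.1 + c * p.2, p.2)] = area A.
Proof.
move=> mA; rewrite !product_lebesgue_measureC//;
  last exact: measurable_shear_fst.
apply: eq_integral => y _ /=.
rewrite -[RHS](lebesgue_measure_translate (c * y));
  last exact: measurable_ysection.
by congr (lebesgue_measure _).
Qed.

(** When [c] is nonzero, the matrix is a product of three shears, with coefficients [x], [c] and
    [y]; the unit determinant accounts for the entry [b]. *)
Let area_SL2_neq0 (a b c d : R) (A : set (mR * mR)) :
  a * d - b * c = 1 -> c != 0 -> measurable A ->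
  area [set p : mR * mR | A (a * p.1 + b * p.2, c * p.1 + d * p.2)] = area A.
Proof.
move=> detM c0 mA; pose x := (a - 1) / c; pose y := (d - 1) / c.
have mA1 := measurable_shear_fst x mA; have mA2 := measurable_shear_snd c mA1.
rewrite -(area_shear_fst x mA) -(area_shear_snd c mA1) -(area_shear_fst y mA2)
  /=.
congr (area _); apply/eq_set => p /=.
have -> : b = (a * d - 1) / c by rewrite -detM; field.
by congr (A (_, _)); rewrite /x /y; field.
Qed.

Lemma area_SL2 (a b c d : R) (A : set (mR * mR)) :
  a * d - b * c = 1 -> measurable A ->
  area [set p : mR * mR | A (a * p.1 + b * p.2, c * p.1 + d * p.2)] = area A.
Proof.
move=> detM mA; have [c0|] := eqVneq c 0; last by move=> c0;
  exact: area_SL2_neq0.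
have d0 : d != 0.
  by apply/eqP => d0; move: detM; rewrite c0 d0 !mulr0 subr0 => /eqP;
    rewrite eq_sym oner_eq0.
(* Factor the given matrix as N J, where J is the quarter turn: the lower left
   entries of N and J are [- d] and [1]. *)
have mN := measurable_linear_preimage (- b) a (- d) 0 mA.
have detN : - b * 0 - a * - d = 1 by rewrite -detM c0; ring.
rewrite -[RHS](area_SL2_neq0 detN _ mA) ?oppr_eq0//.
have detJ : 0 * 0 - (- 1) * 1 = 1 :> R by ring.
rewrite -[RHS](area_SL2_neq0 detJ _ mN) ?oner_eq0//.
congr (area _); apply/eq_set => p /=.
by congr (A (_, _)); rewrite ?c0; ring.
Qed.

End area.

(** * Primitives *)

(** Serves for outer functions such as [asin], whose continuity is established only within a
    segment, end points included. *)
Lemma within_continuous_comp_within (T U V : topologicalType) (A : set T)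
    (B : set U) (f : T -> U) (g : U -> V) : f @` A `<=` B ->
  {within A, continuous f} -> {within B, continuous g} ->
  {within A, continuous (g \o f)}.
Proof.
move=> fAB /subspace_continuousP cf /subspace_continuousP cg.
apply/subspace_continuousP => x Ax; have Bfx : B (f x) by apply: fAB; exists x.
have cfB : f @ within A (nbhs x) --> within B (nbhs (f x)).
  move=> W /= BW; have := cf _ Ax _ BW.
  rewrite !nbhs_simpl /within /=; apply: filterS => y WBf Ay.
  by apply: (WBf Ay); apply: fAB; exists y.
exact: cvg_comp cfB (cg _ Bfx).
Qed.

Section integrals.
Context {R : realType}.
Notation mu := (@lebesgue_measure R).

Lemma ge0_integral_itv_split (f : R -> R) (a b c : R) :
  continuous f -> (forall x, 0 <= f x) -> a <= b -> b <= c ->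
  (\int[mu]_(x in `[a, c]) (f x)%:E =
   \int[mu]_(x in `[a, b]) (f x)%:E + \int[mu]_(x in `[b, c]) (f x)%:E)%E.
Proof.
move=> cf f0 ab bc.
have mf : measurable_fun [set: R] f by exact: continuous_measurable_fun.
rewrite (@itv_bndbnd_setU _ _ _ (BRight b)) ?bnd_simp//.
rewrite ge0_integral_setU//=; first last.
- apply/disj_setPS => y [/=]; rewrite 2!in_itv/= => /andP[_ yx] /andP[].
  by rewrite ltNge yx.
- by move=> x _; rewrite lee_fin.
- exact/measurable_EFinP/measurable_funTS.
congr (_ + _)%E; apply: integral_itv_obnd_cbnd.
exact/measurable_EFinP/measurable_funTS.
Qed.

(** The degenerate case [a = b] is included because the interval [[r / S, r]] below reduces to a
    point when [S = 1]. *)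
Lemma integral_derivative (f F : R -> R) (a b : R) : a <= b ->
  {within `[a, b], continuous f} -> {within `[a, b], continuous F} ->
  {in `]a, b[, forall x : R, is_derive x 1 F (f x)} ->
  (\int[mu]_(x in `[a, b]) (f x)%:E = (F b - F a)%:E)%E.
Proof.
rewrite le_eqVlt => /predU1P[<- _ _ _|ab cf cF dF].
  by rewrite set_itv1 integral_set1 subrr.
have [_ Fa Fb] := (continuous_within_itvP F ab).1 cF.
apply: continuous_FTC2 => //.
- by split => // x xab; have := dF _ xab => -[].
- by move=> x xab; rewrite derive1E;
  exact: (@derive_val _ _ _ _ _ _ _ (dF _ xab)).
Qed.

Lemma continuous_asin_segment : {within `[(-1), 1], continuous (@asin R)}.
Proof.
have pi0 : - (pi / 2) <= pi / 2 :> R by have := pi_ge0 R; lra.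
have := @segment_can_le_continuous R _ _ sin asin pi0.
rewrite sinN sin_pihalf; apply; last exact: sinK.
exact/continuous_subspaceT/continuous_sin.
Qed.

(** The classical primitive of [sqrt (e^2 - u^2)], the half-chord of the disc of radius [e],
    vanishing at 0. *)
Definition disc_primitive (e u : R) : R :=
  (u * Num.sqrt (e ^+ 2 - u ^+ 2) + e ^+ 2 * asin (u / e)) / 2.

Lemma continuous_disc_primitive (e : R) : 0 < e ->
  {within `[- e, e], continuous (disc_primitive e)}.
Proof.
move=> e0; have e_neq0 := lt0r_neq0 e0.
have cscale : {within `[- e, e], continuous (fun u : R => u / e)}.
  by apply: continuous_subspaceT => u; apply: cvgMl; exact: cvg_id.
have casin : {within `[- e, e], continuous ((@asin R) \o (fun u : R => u / e))}.
  apply: within_continuous_comp_within continuous_asin_segment => //.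
  move=> _ /= [u + <-].
  by rewrite /= !in_itv/= ler_pdivrMr// ler_pdivlMr// mul1r mulN1r.
move=> u; apply: cvgMl; apply: cvgD; last by apply: cvgMr; exact: casin.
apply: cvgM.
  by apply: (continuous_subspaceT) => v; exact: cvg_id.
apply: continuous_subspaceT => v.
apply: continuous_comp; last exact: sqrt_continuous.
by apply: cvgB; [exact: cvg_cst|exact: exprn_continuous].
Qed.

Lemma is_derive_disc_primitive (e u : R) : 0 < e -> - e < u < e ->
  is_derive u 1 (disc_primitive e) (Num.sqrt (e ^+ 2 - u ^+ 2)).
Proof.
move=> e0 /andP[Neu ue]; have e_neq0 := lt0r_neq0 e0.
have S0 : 0 < e ^+ 2 - u ^+ 2.
  by rewrite subr_sqr mulr_gt0 ?subr_gt0//; lra.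
set S := Num.sqrt _.
have S_gt0 : 0 < S by rewrite sqrtr_gt0.
have SE : S ^+ 2 = e ^+ 2 - u ^+ 2 by rewrite sqr_sqrtr ?ltW.
have dS : is_derive u 1 (Num.sqrt \o (fun u : R => e ^+ 2 - u ^+ 2))
    ((2 * S)^-1 * (0 - (2%:R * u ^+ 1) *: 1)).
  apply: is_derive1_comp; first exact: is_derive1_sqrt.
  apply: is_deriveB; exact: (@is_deriveX _ _ id 2 u 1 1).
have dA : is_derive u 1 ((@asin R) \o (fun u : R => u * e^-1))
    ((Num.sqrt (1 - (u / e) ^+ 2))^-1 * (u *: 0 + e^-1 *: 1)).
  apply: is_derive1_comp; last exact: (@is_deriveM _ _ id (cst e^-1)).
  by apply: is_derive1_asin;
    rewrite ltr_pdivrMr// ltr_pdivlMr// mul1r mulN1r Neu.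
have eS : Num.sqrt (1 - (u / e) ^+ 2) = S / e.
  have -> : 1 - (u / e) ^+ 2 = (S / e) ^+ 2 by rewrite !expr_div_n SE; field.
  by rewrite sqrtr_sqr ger0_norm// divr_ge0// ltW.
rewrite eS in dA.
have S_neq0 := lt0r_neq0 S_gt0.
have dF : is_derive u 1 (2^-1 *: ((id * (Num.sqrt \o (fun u : R => e ^+ 2 - u
  ^+ 2))) +
    e ^+ 2 *: ((@asin R) \o (fun u : R => u * e^-1))))
    (2^-1 *: ((u *: ((2 * S)^-1 * (0 - (2%:R * u ^+ 1) *: 1)) + S *: 1) +
       e ^+ 2 *: ((S / e)^-1 * (u *: 0 + e^-1 *: 1)))).
  by apply: is_deriveZ; apply: is_deriveD.
have -> : disc_primitive e = 2^-1 *: ((id * (Num.sqrt \o (fun u : R => e ^+ 2 -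
  u ^+ 2))) +
    e ^+ 2 *: ((@asin R) \o (fun u : R => u * e^-1))).
  by apply/funext => x; rewrite /disc_primitive/= [LHS]mulrC.
apply: is_derive_eq dF _.
have scalE (a b : R) : a *: (b : R^o) = a * b by [].
rewrite !scalE; transitivity ((- u ^+ 2 + S ^+ 2 + e ^+ 2) / (2 * S)).
  by field; rewrite e_neq0 S_neq0.
have -> : e ^+ 2 = S ^+ 2 + u ^+ 2 by rewrite SE; ring.
by field.
Qed.

End integrals.

(** * The area of the union of ellipses *)

Section region.
Context {R : realType}.
Notation mR := (measurableTypeR R).
Notation mu := (@lebesgue_measure R).
Implicit Types r S s a b : R.

(* For fixed [a], this is the [s] in [1, S] which maximizes
   [s^2 (2 r^2 - s^2 a^2)]: [r / |a|] clamped to [1, S]. The radius of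
   the disc is [sqrt 2 * r]. *)
Definition best_stretch r S a := r / Num.max (r / S) (Num.min `|a| r).

(** The largest [b^2] over the points [(a, b)] of the union of ellipses. It is negative when
    [a^2 > 2 r^2], where the section is empty. *)
Definition section_bound r S a :=
  best_stretch r S a ^+ 2 * (2 * r ^+ 2 - best_stretch r S a ^+ 2 * a ^+ 2).

(** The coordinates are those of the basis made of [v] and its quarter turn. With [2 r^2] as the
    squared radius, the hyperbolas [|a b| = r^2] touch the circle at [|a| = r] and the longest
    ellipse at [|a| = r / S]. *)
Definition ellipse_union r S : set (mR * mR) :=
  [set p | exists2 s, 1 <= s <= S &
    s ^+ 2 * p.1 ^+ 2 + p.2 ^+ 2 / s ^+ 2 <= 2 * r ^+ 2].

Lemma best_stretch_small r S a : 0 < r -> 1 <= S -> `|a| <= r / S ->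
  best_stretch r S a = S.
Proof.
move=> r0 S1 aS; have S0 : 0 < S by rewrite (lt_le_trans ltr01).
have rS : r / S <= r by rewrite ler_pdivrMr// ler_peMr// ltW.
rewrite /best_stretch min_l ?(le_trans aS)// max_l//.
by field; rewrite !gt_eqF.
Qed.

Lemma best_stretch_mid r S a : 0 < r -> r / S <= `|a| -> `|a| <= r ->
  best_stretch r S a = r / `|a|.
Proof. by move=> r0 Sa ar; rewrite /best_stretch min_l// max_r. Qed.

Lemma best_stretch_large r S a : 0 < r -> 1 <= S -> r <= `|a| ->
  best_stretch r S a = 1.
Proof.
move=> r0 S1 ra; have S0 : 0 < S by rewrite (lt_le_trans ltr01).
have rS : r / S <= r by rewrite ler_pdivrMr// ler_peMr// ltW.
by rewrite /best_stretch min_r// max_r// divff// gt_eqF.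
Qed.

Lemma best_stretch_bounds r S a : 0 < r -> 1 <= S -> 1 <= best_stretch r S a <=
  S.
Proof.
move=> r0 S1; have S0 : 0 < S by rewrite (lt_le_trans ltr01).
have rS0 : 0 < r / S by rewrite divr_gt0.
have [aS|Sa] := leP `|a| (r / S); first by rewrite best_stretch_small// S1 lexx.
have [ar|ra] := leP `|a| r;
  last by rewrite (best_stretch_large r0 S1 (ltW ra)) lexx S1.
have a0 : 0 < `|a| := lt_trans rS0 Sa.
rewrite (best_stretch_mid r0 (ltW Sa) ar) ler_pdivlMr// mul1r ar/=.
by rewrite ler_pdivrMr// mulrC -ler_pdivrMr// ltW.
Qed.

(** For nonzero [a] the left side is a concave parabola in [s^2] with vertex [(r / a)^2], so the
    maximum is at the clamped vertex. The difference of two values factors, and its sign is read off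
    in each of the three ranges of [|a|]. *)
Lemma best_stretch_max r S a s : 0 < r -> 1 <= s <= S ->
  s ^+ 2 * (2 * r ^+ 2 - s ^+ 2 * a ^+ 2) <= section_bound r S a.
Proof.
move=> r0 /andP[s1 sS]; have S1 := le_trans s1 sS.
have S0 : 0 < S by rewrite (lt_le_trans ltr01).
have s0 : 0 < s by rewrite (lt_le_trans ltr01).
have rS0 : 0 < r / S by rewrite divr_gt0.
rewrite /section_bound -subr_ge0 -(real_normK (num_real a)).
set t := best_stretch r S a.
have -> : t ^+ 2 * (2 * r ^+ 2 - t ^+ 2 * `|a| ^+ 2) -
  s ^+ 2 * (2 * r ^+ 2 - s ^+ 2 * `|a| ^+ 2) =
  (t ^+ 2 - s ^+ 2) * (2 * r ^+ 2 - (t ^+ 2 + s ^+ 2) * `|a| ^+ 2) by ring.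
have [aS|Sa] := leP `|a| (r / S).
  rewrite /t best_stretch_small//.
  have sS2 : s ^+ 2 <= S ^+ 2 by rewrite ler_pXn2r // nnegrE ltW.
  have Sa2 : S ^+ 2 * `|a| ^+ 2 <= r ^+ 2.
    rewrite -exprMn ler_pXn2r ?nnegrE ?mulr_ge0 ?(ltW S0) ?(ltW r0)//.
    by rewrite mulrC -ler_pdivlMr.
  apply: mulr_ge0; first by rewrite subr_ge0.
  have := ler_wpM2r (sqr_ge0 `|a|) sS2; lra.
have a0 : 0 < `|a| := lt_trans rS0 Sa.
have [ar|ra] := leP `|a| r.
  rewrite /t (best_stretch_mid r0 (ltW Sa) ar).
  have -> : ((r / `|a|) ^+ 2 - s ^+ 2) * (2 * r ^+ 2 - ((r / `|a|) ^+ 2 + s ^+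
    2) * `|a| ^+ 2) =
    (((r / `|a|) ^+ 2 - s ^+ 2) * `|a|) ^+ 2.
    by field; rewrite gt_eqF.
  exact: sqr_ge0.
rewrite /t (best_stretch_large r0 S1 (ltW ra)) expr1n; apply: mulr_le0.
  by rewrite subr_le0 exprn_ege1.
have ra2 : r ^+ 2 <= `|a| ^+ 2 by rewrite ler_pXn2r ?nnegrE ?(ltW r0) ?(ltW ra).
have s2 : 1 <= s ^+ 2 by rewrite exprn_ege1.
have := ler_wpM2r (sqr_ge0 `|a|) s2; lra.
Qed.

(** Over a fixed abscissa the sections of the ellipses are centred at 0, hence nested, and the
    largest one is attained at [best_stretch]. *)
Lemma ellipse_unionE r S : 0 < r -> 1 <= S ->
  ellipse_union r S = [set p | p.2 ^+ 2 <= section_bound r S p.1].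
Proof.
move=> r0 S1.
have inE s (a b : R) : 1 <= s -> (s ^+ 2 * a ^+ 2 + b ^+ 2 / s ^+ 2 <= 2 * r ^+
  2) =
    (b ^+ 2 <= s ^+ 2 * (2 * r ^+ 2 - s ^+ 2 * a ^+ 2)).
  move=> s1; have s0 : 0 < s by rewrite (lt_le_trans ltr01).
  by rewrite -lerBrDl ler_pdivrMr ?exprn_gt0// mulrC.
apply/seteqP; split => -[a b] /=.
  move=> [s sS]; rewrite inE; last by case/andP: sS.
  by move=> /le_trans; apply; exact: best_stretch_max.
move=> bK; have /andP[s1 sS] := best_stretch_bounds a r0 S1.
by exists (best_stretch r S a); rewrite ?s1// inE.
Qed.

Lemma continuous_best_stretch r S : 0 < r -> 1 <= S ->
  continuous (best_stretch r S).
Proof.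
move=> r0 S1 a; have S0 : 0 < S by rewrite (lt_le_trans ltr01).
apply: cvgMr; apply: cvgV.
  by rewrite gt_eqF// lt_max divr_gt0.
apply: (@continuous_max _ _ (cst (r / S)) (fun a : R => Num.min `|a| r)).
  exact: cvg_cst.
apply: (@continuous_min _ _ (fun a : R => `|a|) (cst r)); last exact: cvg_cst.
exact: norm_continuous.
Qed.

Lemma continuous_section_bound r S : 0 < r -> 1 <= S ->
  continuous (section_bound r S).
Proof.
move=> r0 S1 a.
have cs2 : {for a, continuous (fun a => best_stretch r S a ^+ 2)}.
  apply: (@continuous_comp _ _ _ (best_stretch r S) (fun x => x ^+ 2));
    last exact: exprn_continuous.
  exact: continuous_best_stretch.
apply: cvgM => //; apply: cvgB; first exact: cvg_cst.
by apply: cvgM => //; exact: exprn_continuous.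
Qed.

Lemma measurable_ellipse_union r S : 0 < r -> 1 <= S ->
  measurable (ellipse_union r S).
Proof.
move=> r0 S1; rewrite ellipse_unionE// -[X in measurable X]setTI.
apply: measurable_fun_le => //.
  by apply: measurable_funX; exact: measurable_snd.
apply: (measurableT_comp _ measurable_fst).
apply: continuous_measurable_fun; exact: continuous_section_bound.
Qed.

(** For [K < 0] the set is empty and [Num.sqrt K] takes its default value 0, so one formula covers
    both cases. *)
Lemma lebesgue_measure_sqr_le (K : R) :
  mu [set b : mR | b ^+ 2 <= K] = (2 * Num.sqrt K)%:E.
Proof.
have [K0|K0] := ltP K 0.
  rewrite ltr0_sqrtr// mulr0 (_ : [set b | _] = set0) ?measure0//.
  apply/seteqP; split => b //= /le_lt_trans /(_ K0).
  by rewrite ltNge sqr_ge0.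
have -> : [set b : mR | b ^+ 2 <= K] = `[- Num.sqrt K, Num.sqrt K]%classic.
  apply/seteqP; split => b /=;
    rewrite in_itv/= -ler_norml -sqrtr_sqr ler_sqrt//.
rewrite lebesgue_measure_itv/= lte_fin.
have := sqrtr_ge0 K; rewrite le_eqVlt => /predU1P[<-|K1].
  by rewrite oppr0 ltxx mulr0.
by rewrite gtrN// -EFinB; congr (_%:E); ring.
Qed.

Lemma best_stretchN r S a : best_stretch r S (- a) = best_stretch r S a.
Proof. by rewrite /best_stretch normrN. Qed.

(** The integral splits at [r / S] and [r], where the boundary passes from the longest ellipse to
    the hyperbola and then to the circle. The two values of [disc_primitive] at [r] cancel, leaving
    a quarter of the circle's contribution at [e] and the logarithm. *)
Lemma integral_section_bound e r S : 0 < r -> 0 < e -> e ^+ 2 = 2 * r ^+ 2 ->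
  1 <= S ->
  (\int[mu]_(a in `[0%R, e]) (2 * Num.sqrt (section_bound r S a))%:E =
   (e ^+ 2 * (pi / 2 + ln S))%:E)%E.
Proof.
move=> r0 e0 er S1; have S0 : 0 < S by rewrite (lt_le_trans ltr01).
have rS0 : 0 < r / S by rewrite divr_gt0.
have rS : r / S <= r by rewrite ler_pdivrMr// ler_peMr// ltW.
have re : r <= e.
  rewrite -(@ler_pXn2r _ 2)// ?nnegrE ?(ltW r0) ?(ltW e0)// er.
  by have := sqr_ge0 r; lra.
set f := fun a => 2 * Num.sqrt (section_bound r S a).
have cf : continuous f.
  move=> a; apply: cvgMr.
  apply: (@continuous_comp _ _ _ (section_bound r S));
    last exact: sqrt_continuous.
  exact: continuous_section_bound.
have f0 a : 0 <= f a by rewrite mulr_ge0// sqrtr_ge0.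
have cF := continuous_disc_primitive e0.
have subF (a b : R) : 0 <= a -> b <= e -> {within `[a, b],
  continuous (disc_primitive e)}.
  move=> a0 be; apply: continuous_subspaceW cF; apply: subset_itvScc;
    rewrite bnd_simp//.
  by rewrite (le_trans _ a0)// oppr_le0 ltW.
rewrite (ge0_integral_itv_split cf f0 (ltW r0) re).
rewrite (ge0_integral_itv_split cf f0 (ltW rS0) rS).
(* Here [best_stretch] is [S], and rescaling the abscissa by [S] turns the ellipse into the disc. *)
have -> : (\int[mu]_(a in `[0%R,
  (r / S)%R]) (f a)%:E)%E = (2 * disc_primitive e r - 2 * disc_primitive e
  0)%:E.
  have := @integral_derivative _ f (fun a => 2 * disc_primitive e (S * a)) 0 (r
    / S) (ltW rS0).
  rewrite mulr0 (_ : S * (r / S) = r); last by field; rewrite gt_eqF.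
  apply; first exact: continuous_subspaceT.
    move=> a; apply: cvgMr; move: a.
    apply: (@within_continuous_comp_within _ _ _ _ `[0,
      r] (fun a => S * a) (disc_primitive e)).
    - move=> _ [a /= + <-]; rewrite !in_itv/= => /andP[a0 aS].
      by rewrite mulr_ge0 ?(ltW S0)//= mulrC -ler_pdivlMr.
    - by apply: continuous_subspaceT => a; apply: cvgMr; exact: cvg_id.
    - exact: subF.
  move=> a; rewrite in_itv/= => /andP[a0 aS].
  have Sa : S * a < r by rewrite mulrC -ltr_pdivlMr.
  have Sa0 : 0 < S * a by rewrite mulr_gt0.
  have dS : is_derive a 1 (fun a => S * a) S.
    by apply: is_derive_eq; rewrite /GRing.scale/= mulr1.
  have dC : is_derive a 1 (disc_primitive e \o (fun a => S * a))
      (Num.sqrt (e ^+ 2 - (S * a) ^+ 2) * S).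
    apply: is_derive1_comp => //; apply: is_derive_disc_primitive => //.
    by rewrite (lt_le_trans Sa re) andbT; lra.
  apply: is_derive_eq (is_deriveZ 2 dC) _.
  rewrite /f /section_bound best_stretch_small//; last first.
    by rewrite ger0_norm ltW.
  rewrite sqrtrM ?sqr_ge0// sqrtr_sqr ger0_norm ?ltW// -er exprMn.
  by rewrite [S * Num.sqrt _]mulrC.
(* Here the half-section is [r^2 / a], bounded by the hyperbola. *)
have -> : (\int[mu]_(a in `[(r / S)%R,
  r]) (f a)%:E)%E = (2 * r ^+ 2 * ln r - 2 * r ^+ 2 * ln (r / S))%:E.
  apply: (@integral_derivative _ f (fun a => 2 * r ^+ 2 * ln a)) => //.
  - exact: continuous_subspaceT.
  - apply: continuous_in_subspaceT => a; rewrite inE/= in_itv/= => /andP[aS _].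
    by apply: cvgMr; apply: continuous_ln; exact: lt_le_trans aS.
  move=> a; rewrite in_itv/= => /andP[aS ar].
  have a0 : 0 < a := lt_trans rS0 aS.
  apply: is_derive_eq (is_deriveZ (2 * r ^+ 2) (is_derive1_ln a0)) _.
  rewrite /f /section_bound best_stretch_mid ?ger0_norm ?ltW//.
  have -> : (r / a) ^+ 2 * (2 * r ^+ 2 - (r / a) ^+ 2 * a ^+ 2) = (r ^+ 2 / a)
    ^+ 2.
    by field; rewrite gt_eqF.
  rewrite sqrtr_sqr ger0_norm; last by rewrite divr_ge0 ?sqr_ge0 ?(ltW a0).
  by rewrite [RHS]mulrA.
have -> : (\int[mu]_(a in `[r,
  e]) (f a)%:E)%E = (2 * disc_primitive e e - 2 * disc_primitive e r)%:E.
  apply: (@integral_derivative _ f (fun a => 2 * disc_primitive e a)) => //.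
  - exact: continuous_subspaceT.
  - by move=> a; apply: cvgMr; move: a; apply: subF => //; exact: ltW.
  move=> a; rewrite in_itv/= => /andP[ra ae].
  have a0 : 0 < a := lt_trans r0 ra.
  have Nae : - e < a < e by rewrite ae andbT; lra.
  apply: is_derive_eq (is_deriveZ 2 (is_derive_disc_primitive e0 Nae)) _.
  rewrite /f /section_bound best_stretch_large ?ger0_norm ?(ltW a0) ?(ltW ra)//.
  by rewrite expr1n !mul1r er.
rewrite -!EFinD; congr (_%:E).
have -> : disc_primitive e 0 = 0.
  have asin0 : asin 0 = 0 :> R.
    rewrite -[in LHS](@sin0 R) sinK// in_itv/=.
    by have := pi_ge0 R; lra.
  by rewrite /disc_primitive !mul0r asin0 mulr0 addr0 mul0r.
have -> : disc_primitive e e = e ^+ 2 * pi / 4.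
  have asin1 : asin 1 = pi / 2 :> R.
    rewrite -[in LHS](@sin_pihalf R) sinK// in_itv/=.
    by have := pi_ge0 R; lra.
  by rewrite /disc_primitive subrr sqrtr0 mulr0 divff ?gt_eqF// asin1; field.
by rewrite ln_div// er; field.
Qed.

(** Integrating the lengths of the sections gives the area; the length is even in [a] and vanishes
    beyond [e], so twice the integral over [[0, e]] remains. *)
Lemma area_ellipse_union e r S : 0 < r -> 0 < e -> e ^+ 2 = 2 * r ^+ 2 ->
  1 <= S ->
  ((mu \x mu) (ellipse_union r S) = ((pi + 2 * ln S) * e ^+ 2)%:E)%E.
Proof.
move=> r0 e0 er S1.
pose f a := 2 * Num.sqrt (section_bound r S a).
transitivity (\int[mu]_a (f a)%:E)%E.
  apply: eq_integral => a _ /=; rewrite -lebesgue_measure_sqr_le.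
  congr (mu _); rewrite ellipse_unionE//; apply/seteqP.
  by split => b; rewrite /xsection /= inE.
have cf : continuous f.
  move=> a; apply: cvgMr.
  apply: (@continuous_comp _ _ _ (section_bound r S));
    last exact: sqrt_continuous.
  exact: continuous_section_bound.
have f0 a : 0 <= f a by rewrite mulr_ge0// sqrtr_ge0.
rewrite ge0_symfun_integralT//; last first.
  by move=> a; rewrite /f /= /section_bound best_stretchN sqrrN.
have re : r <= e.
  rewrite -(@ler_pXn2r _ 2)// ?nnegrE ?(ltW r0) ?(ltW e0)// er.
  by have := sqr_ge0 r; lra.
rewrite -set_itvcy (@itv_bndbnd_setU _ _ _ (BRight e)) ?bnd_simp ?(ltW e0)//.
have mf : measurable_fun [set: R] f by exact: continuous_measurable_fun.
rewrite ge0_integral_setU//=; first last.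
- apply/disj_setPS => y [/=]; rewrite 2!in_itv/= => /andP[_ yx] /andP[].
  by rewrite ltNge yx.
- by move=> x _; rewrite lee_fin.
- exact/measurable_EFinP/measurable_funTS.
rewrite [X in (_ + X)%E]integral0_eq ?adde0; last first.
  move=> a /=; rewrite in_itv/= andbT => ea; have a0 := lt_trans e0 ea.
  rewrite /f /section_bound best_stretch_large//; last first.
    by rewrite ger0_norm ?(ltW a0)// (le_trans re)// ltW.
  rewrite expr1n !mul1r -er ler0_sqrtr ?mulr0//.
  by rewrite subr_le0 ler_pXn2r ?nnegrE ?ltW.
by rewrite integral_section_bound// -EFinM; congr (_%:E); field.
Qed.

End region.

(** * Perturbation of a solution *)

Section calculus.
Context {R : realType}.

(* The inequality is assumed only below the level [d], but the conclusion keeps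
   [e] below [d]: look at the first time at which [e] would reach [d]. *)
Lemma gronwall_trapped (e de : R -> R) (K T d : R) : 0 <= K ->
  {within `[0, T], continuous e} ->
  (forall t : R, 0 < t < T -> is_derive t 1 e (de t)) ->
  (forall t : R, 0 < t < T -> e t < d -> de t <= K * e t) ->
  0 <= e 0 -> e 0 * expR (K * T) < d ->
  forall t, 0 <= t <= T -> e t <= e 0 * expR (K * T).
Proof.
move=> K0 ce ede e'le e00 ed.
(* The usual Gronwall argument: [e t * expR (- K * t)] is nonincreasing on [[0, s]] while [e] stays
   below [d]. *)
have bound s : 0 <= s <= T -> (forall t, 0 < t < s -> e t < d) ->
    e s <= e 0 * expR (K * T).
  move=> /andP[s0 sT] ets; pose g t := e t * expR (- K * t).
  have dexp (t : R) : is_derive t 1 (fun t => expR (- K * t)) (- K * expR (- K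
    * t)).
    have dl : is_derive t 1 (fun t => - K * t) (- K).
      by apply: is_derive_eq; rewrite /GRing.scale/= mulr1.
    have := @is_derive1_comp _ expR (fun t => - K * t) t _ _ (is_derive_expR _)
      dl.
    by rewrite mulrC.
  have dg (t : R) : 0 < t < s -> is_derive t 1 g (expR (- K * t) * (de t - K *
    e t)).
    move=> /andP[t0 ts]; have t0T : 0 < t < T by rewrite t0 (lt_le_trans ts).
    have det := ede _ t0T.
    by apply: is_derive_eq (is_deriveM det (dexp t)) _; rewrite /GRing.scale/=;
      ring.
  have : g s <= g 0.
    apply: (@ler0_derive1_le_cc _ g 0 s) => //; rewrite ?bound_itvE//.
    - by move=> t; rewrite in_itv/= => /dg[].
    - move=> t; rewrite in_itv/= => t0s; rewrite derive1E.
      rewrite (@derive_val _ _ _ _ _ _ _ (dg _ t0s)).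
      apply: mulr_ge0_le0; first exact: expR_ge0.
      rewrite subr_le0; apply: e'le; last exact: ets.
      by case/andP: t0s => -> /lt_le_trans ->.
    - move=> t; apply: cvgM.
        by apply: (continuous_subspaceW _ ce); apply: subset_itvScc;
          rewrite bnd_simp.
      apply: continuous_subspaceT => u.
      by apply/differentiable_continuous/derivable1_diffP; have [] := dexp u.
  rewrite /g mulr0 expR0 mulr1 mulNr expRN ler_pdivrMr ?expR_gt0// =>
    /le_trans; apply.
  by rewrite ler_wpM2l// ler_expR ler_wpM2l.
suff ltd t : 0 <= t <= T -> e t < d.
  move=> t tT; apply: bound => // s /andP[s0 st]; apply: ltd.
  by case/andP: tT => _ /(le_trans (ltW st)) ->; rewrite ltW.
move=> /andP[t0 tT]; rewrite ltNge; apply/negP => det.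
have [t1 [t10 t1t det1] t1min] : exists2 t1, [/\ 0 <= t1, t1 <= t & d <= e t1] &
    forall s, 0 <= s < t1 -> e s < d.
  (* Continuity holds only within [[0, T]], so the superlevel set is the trace of a closed set [V];
     the first time is the minimum of the compact set [V] intersected with [[0, t]]. *)
  have /closed_subspaceP [V cV VE] :
      closed (e @^-1` [set u | d <= u] : set (subspace `[0, T])).
    by move/continuous_closedP : ce; apply; exact: closed_ge.
  have inV s : 0 <= s <= T -> V s <-> d <= e s.
    move=> sT; have := congr1 (@^~ s) VE; rewrite /= in_itv/= sT => H.
    split=> Vs.
      by have : (V s /\ true) by []; rewrite H => -[].
    by have : (d <= e s /\ true) by []; rewrite -H => -[].
  have [] := @compact_EVT_min _ R idfun (V `&` `[0, t]).
  - exists t; split; last by rewrite /= in_itv/= t0 lexx.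
    by apply/inV => //; rewrite t0 tT.
  - rewrite setIC; apply: compact_closedI => //; exact: segment_compact.
  - by apply: continuous_subspaceT => s; exact: cvg_id.
  move=> t1; rewrite inE /= in_itv/= => -[Vt1 /andP[t10 t1t]] t1min.
  have t1T := le_trans t1t tT.
  exists t1; first by split => //; apply/inV => //; rewrite t10.
  move=> s /andP[s0 st1]; rewrite ltNge; apply/negP => des.
  suff : t1 <= s by rewrite leNgt st1.
  apply: t1min; rewrite inE; split.
    by apply/inV => //; rewrite s0 (le_trans (ltW st1)).
  by rewrite /= in_itv/= s0 (le_trans (ltW st1)).
have := bound t1; rewrite t10 (le_trans t1t tT) leNgt => /(_ isT) et1.
by move: det1; rewrite leNgt (le_lt_trans _ ed)// leNgt;
  apply/et1 => s /andP[s0 st1]; apply: t1min; rewrite ltW.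
Qed.

End calculus.

(** * Jacobian matrices and a mean value inequality *)

Section jacobian.
Context {R : realType}.
Implicit Types (F : 'cV[R]_2 -> 'cV[R]_2) (p q u : 'cV[R]_2).

Lemma mx_entry_le_norm m n (A : 'M[R]_(m, n)) i j : `|A i j| <= `|A|.
Proof.
rewrite [leRHS]/Num.Def.normr/= mx_normrE.
exact: (le_bigmax _ (fun ij : 'I_m * 'I_n => `|A ij.1 ij.2|) (i, j)).
Qed.

Lemma mx_norm_le m n (A : 'M[R]_(m, n)) (c : R) : 0 <= c ->
  (forall i j, `|A i j| <= c) -> `|A| <= c.
Proof.
move=> c0 Ac; rewrite [leLHS]/Num.Def.normr/= mx_normrE.
by apply: bigmax_le => // -[i j] _; exact: Ac.
Qed.

Lemma sum_ord2 (F : 'I_2 -> R) : \sum_i F i = F 0 + F 1.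
Proof. by rewrite !big_ord_recl big_ord0 addr0; congr (_ + F _);
  exact: val_inj. Qed.

Lemma scale_entry (h : R) (u : 'cV[R]_2) i : (h *: u) i 0 = h * u i 0.
Proof. by rewrite mxE. Qed.

Lemma mulmx_entry (A : 'M[R]_2) (u : 'cV[R]_2) i :
  (A *m u) i 0 = A i 0 * u 0 0 + A i 1 * u 1 0.
Proof. by rewrite mxE sum_ord2. Qed.

Lemma norm_scale_delta (h : R) (j : 'I_2) :
  `|h *: delta_mx j 0 : 'cV[R]_2| <= `|h|.
Proof.
apply: mx_norm_le => // i k; rewrite !mxE normrM ler_piMr//.
by case: (_ && _); rewrite ?normr1 ?normr0.
Qed.

Lemma mulmx_entry_le (L : R) (A : 'M[R]_2) u i : (forall i j, `|A i j| <= L) ->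
  `|(A *m u) i 0| <= 2 * L * `|u|.
Proof.
move=> AL; rewrite mxE; apply: (le_trans (ler_norm_sum _ _ _)).
apply: (@le_trans _ _ (\sum_(k < 2) L * `|u|)).
  by apply: ler_sum => k _; rewrite normrM ler_pM// mx_entry_le_norm.
by rewrite sumr_const card_ord -[leLHS]mulr_natl mulrA.
Qed.

Lemma is_derive_entry (x : R -> 'cV[R]_2) (t : R) (u : 'cV[R]_2) i :
  is_derive t 1 x u -> is_derive t 1 (fun t => x t i 0) (u i 0).
Proof.
move=> [dx xu]; have /derivable_mxP /(_ i 0) dxi := dx.
by split=> //; rewrite -xu derive_mx// mxE.
Qed.

Lemma jac_derive F p u : differentiable F p -> 'D_u F p = jac F p *m u.
Proof.
move=> dF; rewrite deriveE// [u in LHS]matrix_sum_delta linear_sum.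
apply/matrixP => i j; rewrite summxE mxE.
apply: eq_bigr => k _; rewrite big_ord_recl big_ord0 addr0 linearZ/= !mxE.
by rewrite -deriveE// !ord1 mulrC.
Qed.

Lemma is_derive_line F p u (s : R) : (forall q, differentiable F q) ->
  is_derive s 1 (fun s => F (p + s *: u)) (jac F (p + s *: u) *m u).
Proof.
move=> dF; rewrite -jac_derive//.
have E : (fun h : R => h^-1 *: (((fun s => F (p + s *: u)) \o shift s) (h *: 1)
  - F (p + s *: u)))
  = (fun h : R => h^-1 *: ((F \o shift (p + s *: u)) (h *: u) - F (p + s *:
    u))).
  apply/funext => h /=; congr (_ *: (F _ - _)).
  by rewrite [h *: 1]mulr1 scalerDl addrCA.
have := @diff_derivable _ _ _ _ _ u (dF (p + s *: u)).
by split; rewrite /derivable/derive E.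
Qed.

(** The mean value theorem along the segment is applied to one component at a time, as the
    intermediate point depends on [i]. The factor 2 is the number of terms in a row of the matrix
    product. *)
Lemma mean_value_jac F p q (eta : R) i : (forall q, differentiable F q) ->
  (forall (s : R) k, 0 <= s <= 1 ->
    `|jac F (p + s *: (q - p)) i k - jac F p i k| <= eta) ->
  `|(F q - F p - jac F p *m (q - p)) i 0| <= 2 * eta * `|q - p|.
Proof.
move=> dF Jeta; set u := q - p.
pose g s := F (p + s *: u) i 0.
have dg (s : R) : is_derive s 1 g ((jac F (p + s *: u) *m u) i 0).
  exact/(is_derive_entry (x := fun s => F (p + s *: u)))/is_derive_line.
have [|s s01 gE] := @MVT_segment _ g (fun s => (jac F (p + s *: u) *m u) i 0) 0
  1 ler01 (fun s _ => dg s).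
  by apply: continuous_subspaceT => s;
    apply/differentiable_continuous/derivable1_diffP; have [] := dg s.
have {gE} -> : (F q - F p - jac F p *m u) i 0 = ((jac F (p + s *: u) - jac F p)
  *m u) i 0.
  move: gE; rewrite /g scale1r scale0r addr0 [p + u]addrC subrK subr0 mulr1 =>
    gE.
  by rewrite mulmxBl [in LHS]mxE [in RHS]mxE -gE !mxE.
rewrite mxE; apply: (le_trans (ler_norm_sum _ _ _)).
apply: (@le_trans _ _ (\sum_(k < 2) eta * `|u|)).
  apply: ler_sum => k _; rewrite normrM ler_pM//.
  - by rewrite mxE [X in _ + X]mxE; apply: Jeta; move: s01; rewrite in_itv.
  - exact: mx_entry_le_norm.
by rewrite sumr_const card_ord -[leLHS]mulr_natl mulrA.
Qed.

End jacobian.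

(** * Uniform bounds on the Jacobian near the trajectory *)

Section uniformity.
Context {R : realType}.
Variables (f : R -> 'cV[R]_2 -> 'cV[R]_2) (x : R -> 'cV[R]_2) (T : R).
Hypothesis f_smooth : smooth_field f.
Hypothesis cx : {within `[0, T], continuous x}.

Lemma jac_trajectory_bounded : exists2 L, 0 <= L &
  forall t, 0 <= t <= T -> forall i j, `|jac (f t) (x t) i j| <= L.
Proof.
have [T0|T0] := ltP T 0.
  exists 0 => // t /andP[t0 tT] i j.
  by have := lt_le_trans T0 (le_trans t0 tT); rewrite ltxx.
have cJ : {within `[0, T], continuous (fun t => `|jac (f t) (x t)|)}.
  apply/subspace_continuousP => t tT.
  apply: (@cvg_norm _ _ _ _ _ (fun t => jac (f t) (x t))).
  have [_ _ cJ] := f_smooth.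
  have cp : (fun t => (t, x t)) @ within `[0, T] (nbhs t) --> (t, x t).
    have cid : (fun t => t) @ within `[0, T] (nbhs t) --> t.
      by apply: cvg_within_filter; exact: cvg_id.
    move/subspace_continuousP : cx => /(_ _ tT) cxt.
    exact: (@cvg_pair _ _ _ (within `[0,
      T] (nbhs t)) (nbhs t) (nbhs (x t)) _ _ _ (fun t => t) x cid cxt).
  exact: cvg_comp cp (cJ (t, x t)).
have [c cT maxc] := EVT_max T0 cJ.
exists `|jac (f c) (x c)| => // t tT i j.
by apply: (le_trans (mx_entry_le_norm _ _ _)); apply: maxc; rewrite in_itv.
Qed.

(** Joint continuity gives a radius valid near each time, and compactness of [[0, T]], in its
    near-covering form, gives a common one. Both [p] and [x s] are compared with [x t], at a cost of
    [eta / 2] each. *)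
Lemma jac_trajectory_uniform (eta : R) : 0 < eta -> exists2 d, 0 < d &
  forall t, 0 <= t <= T -> forall p, `|p - x t| < d ->
  forall i j, `|jac (f t) p i j - jac (f t) (x t) i j| <= eta.
Proof.
move=> eta0.
have /compact_near_coveringP/near_covering_withinP := @segment_compact R 0 T.
move=> /(_ R 0^'+ (fun d t => forall p, `|p - x t| < d ->
  forall i j, `|jac (f t) p i j - jac (f t) (x t) i j| <= eta) _) cover.
have [|d [d0 dP]] := filter_ex (filterI (nbhs_right_gt (0 : R)) (cover _));
  last first.
  by exists d => // t tT; apply: dP; rewrite /= in_itv.
move=> t tT.
have [_ _ /(_ (t, x t))] := f_smooth.
move=> /cvgrPdist_le/(_ (eta / 2)); rewrite divr_gt0// => /(_ isT).
move=> /nbhs_ballP[r /= r0 rJ].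
have r20 : 0 < r / 2 by rewrite divr_gt0.
have xr : \forall s \near t, `[0, T]%classic s -> `|x t - x s| < r / 2.
  move/subspace_continuousP : cx => /(_ _ tT) /cvgrPdist_lt/(_ (r / 2) r20).
  by rewrite near_withinE.
have close s p : `|t - s| < r -> `|x t - p| < r -> forall i j,
    `|jac (f t) (x t) i j - jac (f s) p i j| <= eta / 2.
  move=> ts xp i j; have rsp : ball (t, x t) r (s, p) by split;
    rewrite -ball_normE.
  have := rJ _ rsp; apply: le_trans.
  rewrite /=; have := mx_entry_le_norm (jac (f t) (x t) - jac (f s) p) i j.
  by rewrite mxE [X in _ + X]mxE.
have tr : \forall s \near t, `|t - s| < r by exact: nbhsx_ballx.
near=> s d => /= sT p pd i j.
have xsr : `|x t - x s| < r / 2 by move: sT; near: s.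
have dr : d < r / 2 by near: d; exact: nbhs_right_lt.
have ts : `|t - s| < r by near: s.
have h1 : `|jac (f t) (x t) i j - jac (f s) p i j| <= eta / 2.
  apply: close => //; have -> : x t - p = (x t - x s) + (x s - p)
    by rewrite addrA subrK.
  apply: (le_lt_trans (ler_normD _ _)); rewrite [ltRHS]splitr ltrD//.
  by rewrite distrC (lt_trans pd).
have h2 : `|jac (f t) (x t) i j - jac (f s) (x s) i j| <= eta / 2.
  by apply: close => //; apply: lt_trans xsr _;
    rewrite ltr_pdivrMr// ltr_pMr// ltr1n.
have -> : jac (f s) p i j - jac (f s) (x s) i j =
  (jac (f t) (x t) i j - jac (f s) (x s) i j) - (jac (f t) (x t) i j - jac (f
    s) p i j) by ring.
by apply: (le_trans (ler_normB _ _)); rewrite [leRHS]splitr lerD.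
Unshelve. all: by end_near. Qed.

End uniformity.

(** * Distance between neighbouring solutions *)

Section perturbation.
Context {R : realType}.
Implicit Types u : 'cV[R]_2.

(** Gronwall's argument needs a differentiable quantity, the sum of squares; this bound and the next
    one translate to and from the sup norm. *)
Lemma sqr_norm_le_sum u : `|u| ^+ 2 <= \sum_i u i 0 ^+ 2.
Proof.
have s0 : 0 <= \sum_i u i 0 ^+ 2 by apply: sumr_ge0 => i _; exact: sqr_ge0.
rewrite -[leRHS]sqr_sqrtr// ler_pXn2r ?nnegrE ?sqrtr_ge0//.
apply: mx_norm_le => [|i j]; first exact: sqrtr_ge0.
rewrite ord1 -sqrtr_sqr ler_sqrt// (bigD1 i)//= lerDl.
by apply: sumr_ge0 => k _; exact: sqr_ge0.
Qed.

Lemma sum_le_sqr_norm u : \sum_i u i 0 ^+ 2 <= 2 * `|u| ^+ 2.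
Proof.
apply: (@le_trans _ _ (\sum_(i < 2) `|u| ^+ 2)).
  apply: ler_sum => i _; rewrite -real_normK ?num_real//.
  by rewrite ler_pXn2r ?nnegrE// mx_entry_le_norm.
by rewrite sumr_const card_ord -[leLHS]mulr_natl.
Qed.

Variables (f : R -> 'cV[R]_2 -> 'cV[R]_2) (T : R).

Lemma within_continuous_entry (A : set R) (y : R -> 'cV[R]_2) i :
  {within A, continuous y} -> {within A, continuous (fun t => y t i 0)}.
Proof.
move=> /subspace_continuousP cy; apply/subspace_continuousP => t At.
exact: cvg_comp (cy t At) (@coord_continuous _ _ _ i 0 (y t)).
Qed.

Lemma solution_entry (y : R -> 'cV[R]_2) (t : R) i : solution f 0 T y ->
  0 < t < T -> is_derive t 1 (fun t => y t i 0) (f t (y t) i 0).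
Proof. by move=> [_ dy] /dy; exact: is_derive_entry. Qed.

Variable x : R -> 'cV[R]_2.
Hypothesis f_smooth : smooth_field f.
Hypothesis x_sol : solution f 0 T x.

Lemma is_derive_diff y i (t : R) : solution f 0 T y -> 0 < t < T ->
  is_derive t 1 (fun t => (y t - x t) i 0) ((f t (y t) - f t (x t)) i 0).
Proof.
move=> y_sol tT.
have -> : (fun t => (y t - x t) i 0) = (fun t => y t i 0) - (fun t => x t i 0).
  by apply/funext => s; rewrite !mxE.
have -> : (f t (y t) - f t (x t)) i 0 = f t (y t) i 0 - f t (x t) i 0.
  by rewrite !mxE.
exact: is_deriveB (solution_entry i y_sol tT) (solution_entry i x_sol tT).
Qed.

Lemma within_continuous_diff y i : solution f 0 T y ->
  {within `[0, T], continuous (fun t => (y t - x t) i 0)}.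
Proof.
move=> [cy _]; apply: (@within_continuous_entry _ (fun t => y t - x t)).
by have [cx _] := x_sol; move=> t; apply: cvgB; [exact: cy|exact: cx].
Qed.

(** The defect of [y - x] in the variational equation along [x]. *)
Definition remainder (y : R -> 'cV[R]_2) t :=
  f t (y t) - f t (x t) - jac (f t) (x t) *m (y t - x t).

Lemma diff_entry y t i :
  (f t (y t) - f t (x t)) i 0 =
  (jac (f t) (x t) *m (y t - x t)) i 0 + remainder y t i 0.
Proof.
rewrite /remainder; set A := f t (y t) - _; set B := _ *m _.
by rewrite [(A - B) i 0]mxE [(- B) i 0]mxE; ring.
Qed.

Lemma remainder_le (eta : R) : 0 < eta -> exists2 d, 0 < d &
  forall t y i, 0 <= t <= T -> `|y t - x t| < d ->
  `|remainder y t i 0| <= eta * `|y t - x t|.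
Proof.
move=> eta0; have eta20 : 0 < eta / 2 by rewrite divr_gt0.
have [_ df _] := f_smooth; have [cx _] := x_sol.
have [d d0 dP] := jac_trajectory_uniform f_smooth cx eta20.
exists d => // t y i tT yd.
have := @mean_value_jac _ (f t) (x t) (y t) (eta / 2) i (df t).
rewrite (_ : 2 * (eta / 2) = eta); last by field.
apply=> s k /andP[s0 s1]; apply: dP => //.
rewrite addrC addKr normrZ (le_lt_trans _ yd)// ler_piMl//.
by rewrite ger0_norm.
Qed.

(** Gronwall's argument is applied to the squared Euclidean distance. The constant [M] is chosen
    before [eta], which only affects the radius [r]. *)
Lemma solution_perturbation : exists2 M, 0 < M & forall eta : R, 0 < eta ->
  exists2 r, 0 < r & forall y, solution f 0 T y -> `|y 0 - x 0| < r ->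
  forall t, 0 <= t <= T -> `|y t - x t| <= M * `|y 0 - x 0| /\
    forall i, `|remainder y t i 0| <= eta * `|y t - x t|.
Proof.
have [cx _] := x_sol.
have [L L0 LP] := jac_trajectory_bounded f_smooth cx.
have [d1 d10 d1P] := remainder_le ltr01.
(* Each component of [y - x] has rate at most [(2 L + 1) |y - x|], where 1 bounds the remainder; the
   derivative of a square and the two components give the factor 4. *)
pose K := 4 * (2 * L + 1).
have K0 : 0 <= K by rewrite mulr_ge0// addr_ge0// mulr_ge0.
pose M := Num.sqrt (2 * expR (K * T)).
have M2 : M ^+ 2 = 2 * expR (K * T) by rewrite sqr_sqrtr// mulr_ge0// expR_ge0.
have M0 : 0 < M by rewrite sqrtr_gt0 mulr_gt0// expR_gt0.
exists M => // eta eta0.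
have [d2 d20 d2P] := remainder_le eta0.
pose d3 := Num.min d1 d2.
have d30 : 0 < d3 by rewrite lt_min d10.
(* This radius keeps [M * |y 0 - x 0|] below [d3], so that the level [d3^2] of the trap is never
   reached. *)
exists (d3 / M) => [|y y_sol y0 t tT]; first by rewrite divr_gt0.
have yM : M * `|y 0 - x 0| < d3 by rewrite mulrC -ltr_pdivlMr.
pose e t := \sum_i (y t - x t) i 0 ^+ 2.
have eE : e = (fun t => (y t - x t) 0 0 ^+ 2) + (fun t => (y t - x t) 1 0 ^+ 2).
  by apply/funext => s; rewrite /e sum_ord2.
suff eM s : 0 <= s <= T -> e s <= e 0 * expR (K * T).
  have yt s : 0 <= s <= T -> `|y s - x s| <= M * `|y 0 - x 0|.
    move=> sT; rewrite -(@ler_pXn2r _ 2)// ?nnegrE ?mulr_ge0 ?(ltW M0)//.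
    rewrite exprMn M2 mulrAC; apply: (le_trans (sqr_norm_le_sum _)).
    apply: (le_trans (eM _ sT)); apply: ler_wpM2r; first exact: expR_ge0.
    exact: sum_le_sqr_norm.
  split=> [|i]; first exact: yt.
  apply: d2P => //; apply: (le_lt_trans (yt _ tT)).
  by apply: (lt_le_trans yM); rewrite ge_min lexx orbT.
move: s; apply: (@gronwall_trapped _ e
  (fun t => \sum_i 2 * (y t - x t) i 0 * (f t (y t) - f t (x t)) i 0) _ _ (d3
    ^+ 2)) => //.
- rewrite eE => s; have cd i := @within_continuous_diff y i y_sol s.
  by apply: cvgD; apply: cvgM; exact: cd.
- move=> s sT; rewrite eE sum_ord2; have dd i := is_derive_diff i y_sol sT.
  have dX i : is_derive s 1 ((fun t => (y t - x t) i 0) * (fun t => (y t - x t)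
    i 0))
      (2 * (y s - x s) i 0 * (f s (y s) - f s (x s)) i 0).
    by apply: is_derive_eq (is_deriveM (dd i) (dd i)) _;
      rewrite /GRing.scale/=; ring.
  exact: is_deriveD (dX 0) (dX 1).
- move=> s /andP[s0 sT] es.
  have ys : `|y s - x s| < d3.
    rewrite -(@ltr_pXn2r _ 2)// ?nnegrE ?(ltW d30)//.
    exact: le_lt_trans (sqr_norm_le_sum _) es.
  have rate i : `|(f s (y s) - f s (x s)) i 0| <= (2 * L + 1) * `|y s - x s|.
    rewrite diff_entry mulrDl; apply: (le_trans (ler_normD _ _)); apply: lerD.
      by apply: mulmx_entry_le => j k; apply: LP; rewrite !ltW.
    apply: d1P; first by rewrite !ltW.
    by apply: (lt_le_trans ys); rewrite ge_min lexx.
  apply: (@le_trans _ _ (\sum_(i < 2) 2 * (2 * L + 1) * `|y s - x s| ^+ 2)).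
    apply: ler_sum => i _; rewrite -!mulrA ler_wpM2l//.
    apply: (le_trans (ler_norm _)); rewrite normrM.
    rewrite (_ : _ * `|y s - x s| ^+ 2 = `|y s - x s| * ((2 * L + 1) * `|y s -
      x s|)); last by ring.
    by apply: ler_pM => //; exact: mx_entry_le_norm.
  rewrite sumr_const card_ord -[leLHS]mulr_natl /K.
  rewrite [leLHS](_ : _ = 4 * (2 * L + 1) * `|y s - x s| ^+ 2); last by ring.
  by apply: ler_wpM2l => //; exact: sqr_norm_le_sum.
- by apply: sumr_ge0 => i _; exact: sqr_ge0.
- apply: (@le_lt_trans _ _ ((M * `|y 0 - x 0|) ^+ 2)).
    rewrite exprMn M2 [leRHS]mulrAC; apply: ler_wpM2r; first exact: expR_ge0.
    exact: sum_le_sqr_norm.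
  by rewrite ltr_pXn2r ?nnegrE ?mulr_ge0 ?(ltW M0) ?(ltW d30).
Qed.

End perturbation.

(** * The fundamental matrix *)

Section flow.
Context {R : realType}.
Variables (f : R -> 'cV[R]_2 -> 'cV[R]_2).
Variables (phi : R -> R -> 'cV[R]_2 -> 'cV[R]_2) (x : R -> 'cV[R]_2) (T : R).
Hypothesis f_smooth : smooth_field f.
Hypothesis phi_flow : is_flow f phi.
Hypothesis T_ge0 : 0 <= T.
Hypothesis x_sol : solution f 0 T x.

Notation W := (fundamental_matrix phi x 0).

Let W_entry i j t :
  W t i j = ('D_(delta_mx j 0) (phi 0 t) (x 0)) i 0.
Proof. by rewrite /fundamental_matrix /jac mxE. Qed.

Lemma solution_restrict y (t : R) : t <= T -> solution f 0 T y -> solution f 0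
  t y.
Proof.
move=> tT [cy dy]; split.
  by apply: continuous_subspaceW cy; apply: subset_itvScc; rewrite bnd_simp.
by move=> s /andP[s0 st]; apply: dy; rewrite s0 (lt_le_trans st).
Qed.

Lemma solution_between0 y (t : R) : 0 <= t <= T -> solution f 0 T y ->
  solution_between f 0 t y.
Proof.
move=> /andP[t0 tT] y_sol; rewrite /solution_between min_l// max_r//.
exact: solution_restrict y_sol.
Qed.

Lemma solution_flow y (t : R) : 0 <= t <= T -> solution f 0 T y ->
  y t = phi 0 t (y 0).
Proof.
by move=> tT y_sol; have [_ + _] := phi_flow; apply; exact: solution_between0.
Qed.

Definition flow_quotient j t h : 'cV[R]_2 :=
  h^-1 *: (phi 0 t (h *: delta_mx j 0 + x 0) - phi 0 t (x 0)).

Lemma flow_quotient_cvg i j (t : R) : 0 <= t <= T ->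
  (fun h => flow_quotient j t h i 0) @ 0^' --> W t i j.
Proof.
move=> tT; have [_ _ /(_ 0 t (x 0))[|_ dphi]] := phi_flow.
  by exists x => //; exact: solution_between0.
have dv : derivable (phi 0 t) (x 0) (delta_mx j 0) by exact: diff_derivable.
rewrite W_entry.
exact: cvg_comp dv (@coord_continuous _ _ _ i 0 _).
Qed.

(** The initial state [x 0] is interior to the flow domain for time [T], so solutions from nearby
    states exist on all of [[0, T]]. *)
Lemma near_perturbed_solution (r : R) j : 0 < r -> \forall h \near 0^',
  exists y, [/\ solution f 0 T y, `|y 0 - x 0| < r,
    y 0 - x 0 = h *: delta_mx j 0 &
    forall t, 0 <= t <= T -> y t - x t = h *: flow_quotient j t h].
Proof.
move=> r0; have [_ _ /(_ 0 T (x 0))[|dom _]] := phi_flow.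
  by exists x => //; apply: solution_between0 => //; rewrite lexx T_ge0.
have ch : (fun h : R => h *: delta_mx j 0 + x 0) @ 0^' --> x 0.
  have : (fun h : R => h *: delta_mx j 0 + x 0) @ (0 : R) --> 0 *: delta_mx j 0
    + x 0.
    by apply: cvgD; [exact: scalel_continuous|exact: cvg_cst].
  by rewrite scale0r add0r; exact: cvg_within_filter.
near=> h.
have h0 : h != 0 by near: h; exact: nbhs_dnbhs_neq.
have [y y_sol yE] : flow_domain f 0 T (h *: delta_mx j 0 + x 0).
  by near: h; exact: (ch _ dom).
rewrite /solution_between min_l// max_r// in y_sol.
have y0 : y 0 - x 0 = h *: delta_mx j 0 by rewrite yE addrK.
exists y; split=> //.
  by rewrite yE distrC; near: h; exact: ((cvgrPdist_lt _ _).1 ch _ r0).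
move=> t tT; rewrite (solution_flow tT y_sol) (solution_flow tT x_sol) yE.
by rewrite /flow_quotient scalerA divff// scale1r.
Unshelve. all: by end_near. Qed.

(** The mean value theorem in time bounds the increments of the difference quotients independently
    of [h], and the bound passes to the limit. *)
Lemma fundamental_matrix_lipschitz : exists2 C, 0 <= C &
  forall (s t : R) i j, 0 <= s -> s <= t -> t <= T ->
    `|W t i j - W s i j| <= C * (t - s).
Proof.
have [cx _] := x_sol.
have [L L0 LP] := jac_trajectory_bounded f_smooth cx.
have [M M0 pert] := solution_perturbation f_smooth x_sol.
have [r r0 rP] := pert 1 ltr01.
pose C := (2 * L + 1) * M; exists C.
  by rewrite mulr_ge0 ?(ltW M0)// addr_ge0// mulr_ge0.
move=> s t i j s0 st tT.
have tT' : 0 <= t <= T by rewrite (le_trans s0 st).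
have sT' : 0 <= s <= T by rewrite s0 (le_trans st tT).
have cvgd : (fun h => `|flow_quotient j t h i 0 - flow_quotient j s h i 0|) @
  0^'
    --> `|W t i j - W s i j|.
  by apply: cvg_norm; apply: cvgB; exact: flow_quotient_cvg.
rewrite -(cvg_lim _ cvgd)//; apply: limr_le; first by apply/cvg_ex; eexists;
  exact: cvgd.
near=> h.
have h0 : h != 0 by near: h; exact: nbhs_dnbhs_neq.
have [y [y_sol yr yh yq]] : exists y, [/\ solution f 0 T y, `|y 0 - x 0| < r,
    y 0 - x 0 = h *: delta_mx j 0 &
    forall t, 0 <= t <= T -> y t - x t = h *: flow_quotient j t h].
  by near: h; exact: near_perturbed_solution.
have yP := rP y y_sol yr.
pose g u := (y u - x u) i 0.
have [u| |c cst gE] := @MVT_segment _ g (fun u => (f u (y u) - f u (x u)) i 0)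
  s t st.
- rewrite in_itv/= => /andP[su ut]; apply: (is_derive_diff x_sol) => //.
  by rewrite (le_lt_trans s0 su) (lt_le_trans ut tT).
- have := @within_continuous_diff _ _ _ _ x_sol y i y_sol;
  apply: continuous_subspaceW.
  by apply: subset_itvScc; rewrite bnd_simp.
have cT : 0 <= c <= T.
  by move: cst; rewrite in_itv/= => /andP[sc ct];
    rewrite (le_trans s0 sc) (le_trans ct tT).
have [yM yrem] := yP c cT.
have rate : `|(f c (y c) - f c (x c)) i 0| <= C * `|h|.
  apply: (@le_trans _ _ ((2 * L + 1) * `|y c - x c|)).
    rewrite (diff_entry f x) mulrDl; apply: (le_trans (ler_normD _ _)).
    by apply: lerD (yrem i); apply: mulmx_entry_le => k l; exact: LP.
  rewrite /C -mulrA; apply: ler_wpM2l; first by rewrite addr_ge0// mulr_ge0.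
  by apply: (le_trans yM); rewrite yh ler_wpM2l ?(ltW M0)// norm_scale_delta.
have -> : flow_quotient j t h i 0 - flow_quotient j s h i 0 = (g t - g s) / h.
  by rewrite /g yq// yq// !scale_entry; field.
rewrite gE 2!normrM normfV ler_pdivrMr ?normr_gt0//.
rewrite [X in _ * X <= _]ger0_norm ?subr_ge0// mulrAC.
by apply: ler_wpM2r rate; rewrite subr_ge0.
Unshelve. all: by end_near. Qed.

Hypothesis f_div0 : forall t p, divergence (f t) p = 0.

(** The determinant [D] of two perturbations starts at [h^2], equals [h^2 * q h] at time [t], and
    has a derivative bounded by a small multiple of [h^2]; hence [q h] tends to 1. *)
Lemma fundamental_matrix_det (t : R) : 0 <= t <= T ->
  W t 0 0 * W t 1 1 - W t 1 0 * W t 0 1 = 1.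
Proof.
move=> tT; have /andP[t0 tT'] := tT.
have [M M0 pert] := solution_perturbation f_smooth x_sol.
pose q h := flow_quotient 0 t h 0 0 * flow_quotient 1 t h 1 0 -
  flow_quotient 0 t h 1 0 * flow_quotient 1 t h 0 0.
have cvgq : q h @[h --> 0^'] --> W t 0 0 * W t 1 1 - W t 1 0 * W t 0 1.
  by apply: cvgB; apply: cvgM; exact: flow_quotient_cvg.
suff : q h @[h --> 0^'] --> (1 : R) by move/(cvg_unique _ cvgq) => ->.
apply/cvgrPdist_le => e e0.
(* The derivative of [D] has four terms, each at most [eta M^2 h^2]; [t + 1] in place of [t] keeps
   [c0] positive at [t = 0]. *)
pose c0 := 4 * M ^+ 2 * (t + 1).
have c00 : 0 < c0 by rewrite !mulr_gt0// ?exprn_gt0// ltr_wpDl.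
pose eta := e / c0.
have eta0 : 0 < eta by rewrite divr_gt0.
have [r r0 rP] := pert eta eta0.
near=> h.
have h0 : h != 0 by near: h; exact: nbhs_dnbhs_neq.
have [y [y_sol yr yh yq]] : exists y, [/\ solution f 0 T y, `|y 0 - x 0| < r,
    y 0 - x 0 = h *: delta_mx 0 0 &
    forall t, 0 <= t <= T -> y t - x t = h *: flow_quotient 0 t h].
  by near: h; exact: near_perturbed_solution.
have [z [z_sol zr zh zq]] : exists y, [/\ solution f 0 T y, `|y 0 - x 0| < r,
    y 0 - x 0 = h *: delta_mx 1 0 &
    forall t, 0 <= t <= T -> y t - x t = h *: flow_quotient 1 t h].
  by near: h; exact: near_perturbed_solution.
pose D u := (y u - x u) 0 0 * (z u - x u) 1 0 - (y u - x u) 1 0 * (z u - x u) 0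
  0.
pose ry u i := remainder f x y u i 0.
pose rz u i := remainder f x z u i 0.
(* The linear part of the equation contributes the trace of the Jacobian times [D], which is 0; only
   remainder terms are left. *)
pose dD u := ry u 0 * (z u - x u) 1 0 + (y u - x u) 0 0 * rz u 1 -
  (ry u 1 * (z u - x u) 0 0 + (y u - x u) 1 0 * rz u 0).
have dDP (u : R) : 0 < u < T -> is_derive u 1 D (dD u).
  move=> uT.
  have dy i := is_derive_diff x_sol i y_sol uT.
  have dz i := is_derive_diff x_sol i z_sol uT.
  apply: is_derive_eq (is_deriveB (is_deriveM (dy 0) (dz 1)) (is_deriveM (dy 1)
    (dz 0))) _.
  rewrite !(diff_entry f x) /dD -/(ry u 0) -/(ry u 1) -/(rz u 0) -/(rz u 1)
    !mulmx_entry.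
  have tr0 : jac (f u) (x u) 0 0 + jac (f u) (x u) 1 1 = 0.
    by rewrite -(f_div0 u (x u)) /divergence sum_ord2 /jac !mxE.
  move: (jac (f u) (x u)) tr0 => A tr0.
  have -> : A 1 1 = - A 0 0 by apply/eqP; rewrite -addr_eq0 addrC tr0.
  by rewrite /GRing.scale/=; ring.
have cD : {within `[0, t], continuous D}.
  have cT w i : solution f 0 T w -> {within `[0, t],
    continuous (fun u => (w u - x u) i 0)}.
    move=> w_sol; have := @within_continuous_diff _ _ _ _ x_sol w i w_sol;
      apply: continuous_subspaceW.
    by apply: subset_itvScc; rewrite bnd_simp.
  by move=> u; apply: cvgB; apply: cvgM; apply: cT.
have [u|c ct DE] := @MVT_segment _ D dD 0 t t0 _ cD.
  rewrite in_itv/= => /andP[u0 ut]; apply: dDP.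
  by rewrite u0 (lt_le_trans ut).
have cT : 0 <= c <= T.
  by move: ct; rewrite in_itv/= => /andP[-> /le_trans ->].
have [yM yrem] := rP y y_sol yr c cT.
have [zM zrem] := rP z z_sol zr c cT.
have dDle : `|dD c| <= 4 * eta * M ^+ 2 * `|h| ^+ 2.
  have sol_le (w : R -> 'cV[R]_2) (j : 'I_2) : w 0 - x 0 = h *: delta_mx j 0 ->
      `|w c - x c| <= M * `|w 0 - x 0| -> `|w c - x c| <= M * `|h|.
    by move=> -> /le_trans; apply;
      rewrite ler_wpM2l ?(ltW M0)// norm_scale_delta.
  have entry_le (w : R -> 'cV[R]_2) i : `|w c - x c| <= M * `|h| ->
      `|(w c - x c) i 0| <= M * `|h|.
    exact/le_trans/mx_entry_le_norm.
  have rem_le (w : R -> 'cV[R]_2) i : `|w c - x c| <= M * `|h| ->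
      `|remainder f x w c i 0| <= eta * `|w c - x c| ->
      `|remainder f x w c i 0| <= eta * (M * `|h|).
    by move=> wM /le_trans; apply; rewrite ler_wpM2l// ltW.
  have yh' := sol_le _ _ yh yM; have zh' := sol_le _ _ zh zM.
  have prod_le (a b : R) : `|a| <= eta * (M * `|h|) -> `|b| <= M * `|h| ->
      `|a * b| <= eta * M ^+ 2 * `|h| ^+ 2.
    move=> ab bb; rewrite normrM (_ : eta * _ * _ = eta * (M * `|h|) * (M *
      `|h|)); last by ring.
    exact: ler_pM.
  rewrite (_ : 4 * _ * _ * _ = eta * M ^+ 2 * `|h| ^+ 2 + eta * M ^+ 2 * `|h|
    ^+ 2 +
    (eta * M ^+ 2 * `|h| ^+ 2 + eta * M ^+ 2 * `|h| ^+ 2)); last by ring.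
  apply: (le_trans (ler_normB _ _)); apply: lerD;
    apply: (le_trans (ler_normD _ _)); apply: lerD.
  - by apply: prod_le; [exact: rem_le|exact: entry_le].
  - by rewrite mulrC; apply: prod_le; [exact: rem_le|exact: entry_le].
  - by apply: prod_le; [exact: rem_le|exact: entry_le].
  - by rewrite mulrC; apply: prod_le; [exact: rem_le|exact: entry_le].
have D0 : D 0 = h ^+ 2.
  rewrite /D yh zh !mxE /=; ring.
have DqE : D t = h ^+ 2 * q h.
  by rewrite /D yq// zq// /q !scale_entry; ring.
have qE : q h - 1 = dD c * t / h ^+ 2.
  rewrite -[t]subr0 -DE DqE D0; field; exact: h0.
rewrite distrC qE normrM normfV ler_pdivrMr ?normr_gt0 ?expf_neq0//.
rewrite normrM (ger0_norm t0) normrX;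
  apply: (@le_trans _ _ (4 * eta * M ^+ 2 * `|h| ^+ 2 * t)).
  exact: ler_wpM2r.
rewrite mulrAC; apply: ler_wpM2r; first exact: sqr_ge0.
have -> : e = 4 * eta * M ^+ 2 * (t + 1).
  by rewrite /eta /c0; field; rewrite !gt_eqF// ltr_wpDl.
apply: ler_wpM2l; last by rewrite lerDl.
apply: mulr_ge0 (sqr_ge0 _); apply: mulr_ge0 (ltW eta0); exact: ler0n.
Unshelve. all: by end_near. Qed.

End flow.

(** * Singular values *)

Section singular_values.
Context {R : realType}.
Implicit Types (A : 'M[R]_2) (u v : 'cV[R]_2) (s : R).

Lemma enorm_sqr u : enorm u ^+ 2 = u 0 0 ^+ 2 + u 1 0 ^+ 2.
Proof. by rewrite /enorm sum_ord2 sqr_sqrtr// addr_ge0// sqr_ge0. Qed.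

Lemma det_ord2 A : \det A = A 0 0 * A 1 1 - A 0 1 * A 1 0.
Proof.
rewrite (expand_det_row _ 0) sum_ord2 /cofactor !det_mx11 !mxE /=.
rewrite !expr0 !expr1 !mul1r mulN1r mulrN.
by congr (_ * A _ _ - _ * A _ _); exact: val_inj.
Qed.

Lemma right_singular_vectorP A s v : right_singular_vector A s v ->
  [/\ v 0 0 ^+ 2 + v 1 0 ^+ 2 = 1,
    (A 0 0 ^+ 2 + A 1 0 ^+ 2) * v 0 0 + (A 0 0 * A 0 1 + A 1 0 * A 1 1) * v 1 0
      = s ^+ 2 * v 0 0 &
    (A 0 0 * A 0 1 + A 1 0 * A 1 1) * v 0 0 + (A 0 1 ^+ 2 + A 1 1 ^+ 2) * v 1 0
      = s ^+ 2 * v 1 0].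
Proof.
move=> [v1 Av]; split; first by rewrite -enorm_sqr v1 expr1n.
  have := congr1 (fun u => u 0 0) Av.
  by rewrite scale_entry -mulmxA mulmx_entry !mxE !sum_ord2 => <-; ring.
have := congr1 (fun u => u 1 0) Av.
by rewrite scale_entry -mulmxA mulmx_entry !mxE !sum_ord2 => <-; ring.
Qed.

Lemma right_singular_vector_sqr A s v : right_singular_vector A s v ->
  s ^+ 2 = (A 0 0 * v 0 0 + A 0 1 * v 1 0) ^+ 2 +
    (A 1 0 * v 0 0 + A 1 1 * v 1 0) ^+ 2.
Proof.
case/right_singular_vectorP; move: (v 0 0) (v 1 0) => a b ab1 E0 E1.
transitivity ((s ^+ 2 * a) * a + (s ^+ 2 * b) * b).
  by rewrite -[LHS]mulr1 -ab1; ring.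
by rewrite -E0 -E1; ring.
Qed.

(* In the orthonormal basis formed by [v] and its quarter turn, A^T A is
   diagonal, and its determinant is 1. *)
Lemma right_singular_vector_turn A s v : \det A = 1 ->
  right_singular_vector A s v ->
  (A 0 0 * v 0 0 + A 0 1 * v 1 0) * (A 0 1 * v 0 0 - A 0 0 * v 1 0) +
  (A 1 0 * v 0 0 + A 1 1 * v 1 0) * (A 1 1 * v 0 0 - A 1 0 * v 1 0) = 0 /\
  s ^+ 2 * ((A 0 1 * v 0 0 - A 0 0 * v 1 0) ^+ 2 +
            (A 1 1 * v 0 0 - A 1 0 * v 1 0) ^+ 2) = 1.
Proof.
rewrite det_ord2 => detA sv; have sE := right_singular_vector_sqr sv.
case/right_singular_vectorP : sv; move: sE.
move: (v 0 0) (v 1 0) (A 0 0) (A 0 1) (A 1 0) (A 1 1) detA.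
move=> a b A00 A01 A10 A11 detA sE ab1 E0 E1.
have cross : (A00 * a + A01 * b) * (A01 * a - A00 * b) +
    (A10 * a + A11 * b) * (A11 * a - A10 * b) = 0.
  transitivity (s ^+ 2 * b * a - s ^+ 2 * a * b); last by ring.
  by rewrite -E0 -E1; ring.
split=> //.
(* Lagrange's identity for the images of [v] and of its quarter turn. *)
transitivity (((a ^+ 2 + b ^+ 2) * (A00 * A11 - A01 * A10)) ^+ 2 +
   ((A00 * a + A01 * b) * (A01 * a - A00 * b) +
   (A10 * a + A11 * b) * (A11 * a - A10 * b)) ^+ 2).
  by rewrite sE; ring.
by rewrite cross ab1 detA; ring.
Qed.

Lemma right_singular_value_neq0 A s v : \det A = 1 ->
  right_singular_vector A s v -> s != 0.
Proof.
move=> detA /(right_singular_vector_turn detA) [_ smu].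
by apply/eqP => s0; move: smu; rewrite s0 expr0n mul0r => /eqP;
  rewrite eq_sym oner_eq0.
Qed.

(** The images of [v] and of its quarter turn are orthogonal, with squared lengths [s^2] and
    [1 / s^2]; Pythagoras applies to the decomposition of [p]. *)
Lemma right_singular_vector_form A s v p : \det A = 1 ->
  right_singular_vector A s v ->
  enorm (A *m p) ^+ 2 =
    s ^+ 2 * (v 0 0 * p 0 0 + v 1 0 * p 1 0) ^+ 2 +
    (- v 1 0 * p 0 0 + v 0 0 * p 1 0) ^+ 2 / s ^+ 2.
Proof.
move=> detA sv; have s0 := right_singular_value_neq0 detA sv.
have [cross smu] := right_singular_vector_turn detA sv.
have sE := right_singular_vector_sqr sv.
have [ab1 _ _] := right_singular_vectorP sv.
rewrite enorm_sqr !mulmx_entry; move: cross smu sE ab1.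
move: (v 0 0) (v 1 0) (p 0 0) (p 1 0) (A 0 0) (A 0 1) (A 1 0) (A 1 1).
move=> a b x y A00 A01 A10 A11 cross.
set mu := (_ ^+ 2 + _ ^+ 2) => smu sE ab1.
have -> : (- b * x + a * y) ^+ 2 / s ^+ 2 = mu * (- b * x + a * y) ^+ 2.
  by rewrite -[LHS]mul1r -smu; field.
transitivity ((a ^+ 2 + b ^+ 2) ^+ 2 * ((A00 * x + A01 * y) ^+ 2 + (A10 * x +
  A11 * y) ^+ 2)).
  by rewrite ab1; ring.
transitivity (s ^+ 2 * (a * x + b * y) ^+ 2 + mu * (- b * x + a * y) ^+ 2 +
  2 * (a * x + b * y) * (- b * x + a * y) * ((A00 * a + A01 * b) * (A01 * a -
    A00 * b) +
     (A10 * a + A11 * b) * (A11 * a - A10 * b))).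
  by rewrite sE /mu; ring.
by rewrite cross mulr0 addr0.
Qed.

(** The inverse of [s] is also a singular value, attained at the quarter turn of [v], so
    [1 / s <= s]. *)
Lemma largest_singular_value_ge1 A s v : \det A = 1 ->
  right_singular_vector A s v -> largest_singular_value A s -> 1 <= s.
Proof.
move=> detA sv [[s_ge0 _] smax].
have s_neq0 := right_singular_value_neq0 detA sv.
have s_gt0 : 0 < s by rewrite lt_def s_neq0.
suff : s^-1 <= s.
  by rewrite -[s^-1]mul1r ler_pdivrMr// -expr2 -[leLHS](expr1n _ 2) ler_pXn2r//
    ?nnegrE.
apply: smax; split; first by rewrite invr_ge0.
(* Eigenvectors are row vectors for [eigenvalue], hence the transposed quarter turn. *)
apply/eigenvalueP; pose w : 'rV[R]_2 := \row_i (if i == 0 then - v 1 0 else v 0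
  0).
have [cross smu] := right_singular_vector_turn detA sv.
have [ab1 E0 E1] := right_singular_vectorP sv.
have sE := right_singular_vector_sqr sv.
(* The two eigenvalues of [A^T *m A] add up to its trace. *)
have muE : s^-1 ^+ 2 = A 0 0 ^+ 2 + A 1 0 ^+ 2 + (A 0 1 ^+ 2 + A 1 1 ^+ 2) - s
  ^+ 2.
  transitivity ((A 0 1 * v 0 0 - A 0 0 * v 1 0) ^+ 2 +
            (A 1 1 * v 0 0 - A 1 0 * v 1 0) ^+ 2).
    by rewrite -[LHS]mulr1 -smu; field.
  rewrite sE; apply/eqP; rewrite eq_sym subr_eq; apply/eqP.
  rewrite -[LHS]mul1r -ab1; ring.
exists w; last first.
  apply/eqP => /rowP w0; move: ab1; have := w0 0; have := w0 1.
  by rewrite !mxE/= => -> /eqP; rewrite oppr_eq0 => /eqP -> /eqP;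
    rewrite expr0n addr0 eq_sym oner_eq0.
apply/rowP => i; rewrite !mxE sum_ord2 !mxE !sum_ord2 !mxE /= muE.
have [->|->] : i = 0 \/ i = 1.
  by case: i => -[|[|//]] ?; [left|right]; exact: val_inj.
all: rewrite /=.
  by rewrite mulrN mulrBl -E1; ring.
by rewrite mulrBl -E0; ring.
Qed.

Lemma mem_stretched_image A eps (p : 'cV[R]_2) : \det A = 1 ->
  [set invmx A *m u | u in eball eps] p <-> enorm (A *m p) <= eps.
Proof.
move=> detA; have Au : A \in unitmx by rewrite unitmxE detA unitr1.
split=> [[u ueps <-]|peps]; first by rewrite mulmxA mulmxV// mul1mx.
by exists (A *m p) => //; rewrite mulmxA mulVmx// mul1mx.
Qed.

End singular_values.

(** * Range of the stretching and area of the union *)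

Lemma fundamental_matrix_diag (R : realType) (f : R -> 'cV[R]_2 -> 'cV[R]_2)
    (phi : R -> R -> 'cV[R]_2 -> 'cV[R]_2) (x : R -> 'cV[R]_2) (s : R) :
  is_flow f phi -> fundamental_matrix phi x s s = 1%:M.
Proof.
move=> [_ flow _]; have phi_id : phi s s = id.
  (* On a one-point interval every function is a solution, in particular the constant [p]. *)
  apply/funext => p; rewrite /= -(flow s s (cst p))//.
  rewrite /solution_between minxx maxxx; split.
    by apply: continuous_subspaceT => t; exact: cvg_cst.
  by move=> t /andP[st ts]; have := lt_trans st ts; rewrite ltxx.
rewrite /fundamental_matrix /jac phi_id; apply/matrixP => i j.
by rewrite mxE derive_id !mxE eqxx andbT.
Qed.

Lemma within_continuous_lipschitz (R : realType) (g : R -> R) (a b C : R) :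
  0 <= C ->
  (forall s t, a <= s -> s <= t -> t <= b -> `|g t - g s| <= C * (t - s)) ->
  {within `[a, b], continuous g}.
Proof.
move=> C0 lip; apply/subspace_continuousP => t;
  rewrite /= in_itv/= => /andP[at_ tb].
apply/cvgrPdist_le => e e0; rewrite near_withinE.
have C1 : 0 < C + 1 by rewrite ltr_wpDl.
have : \forall s \near t, `|t - s| < e / (C + 1).
  by apply: nbhsx_ballx; rewrite divr_gt0.
apply: filterS => s; rewrite ltr_pdivlMr// => ts;
  rewrite /= in_itv/= => /andP[as_ sb].
have le_e : C * `|t - s| <= e.
  apply: le_trans (ltW ts); rewrite mulrC; apply: ler_wpM2l => //.
  by rewrite lerDl.
apply: le_trans le_e; have [st|/ltW ts'] := leP s t.
  by rewrite (@ger0_norm _ (t - s)) ?subr_ge0//; exact: lip.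
by rewrite distrC (distrC t) (@ger0_norm _ (s - t)) ?subr_ge0//; exact: lip.
Qed.

Theorem proposition3 (R : realType)
    (f : R -> 'cV[R]_2 -> 'cV[R]_2)
    (phi : R -> R -> 'cV[R]_2 -> 'cV[R]_2)
    (T eps : R) (x : R -> 'cV[R]_2) (sigma : R -> R) (v : 'cV[R]_2)
    (f_smooth : smooth_field f)
    (f_div0 : forall t p, divergence (f t) p = 0)
    (phi_flow : is_flow f phi)
    (T_gt0 : 0 < T) (eps_gt0 : 0 < eps)
    (x_sol : solution f 0 T x)
    (sigmaP : forall t : R, 0 <= t <= T ->
      largest_singular_value (fundamental_matrix phi x 0 t) (sigma t))
    (v_right : forall t : R, 0 <= t <= T ->
      right_singular_vector (fundamental_matrix phi x 0 t) (sigma t) v)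
    (sigma_max : forall t : R, 0 <= t <= T -> sigma t <= sigma T) :
  vol (stretched_union (fundamental_matrix phi x 0) T eps) =
  ((pi + 2 * ln (sigma T)) * eps ^+ 2)%:E.
Proof.
set W := fundamental_matrix phi x 0 in sigmaP v_right *.
have T_ge0 := ltW T_gt0.
have detW (t : R) : 0 <= t <= T -> \det (W t) = 1.
  move=> tT; rewrite det_ord2 -(fundamental_matrix_det f_smooth phi_flow T_ge0
    x_sol f_div0 tT).
  by congr (_ - _); rewrite mulrC.
have sigma_ge1 (t : R) : 0 <= t <= T -> 1 <= sigma t.
  move=> tT; exact: largest_singular_value_ge1 (detW _ tT) (v_right _ tT)
    (sigmaP _ tT).
have TT : 0 <= T <= T by rewrite T_ge0 lexx.
have T0 : 0 <= (0 : R) <= T by rewrite lexx T_ge0.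
have [ab1 _ _] := right_singular_vectorP (v_right _ TT).
(* The length of [W t *m v] equals [sigma t] on [[0, T]] because [v] is fixed, and inherits
   continuity from the entries of [W]. *)
pose g t := Num.sqrt ((W t 0 0 * v 0 0 + W t 0 1 * v 1 0) ^+ 2 +
    (W t 1 0 * v 0 0 + W t 1 1 * v 1 0) ^+ 2).
have gE (t : R) : 0 <= t <= T -> g t = sigma t.
  move=> tT; rewrite /g -(right_singular_vector_sqr (v_right _ tT)) sqrtr_sqr.
  by rewrite ger0_norm// (le_trans ler01)// sigma_ge1.
have g0 : g 0 = 1.
  rewrite /g /W (fundamental_matrix_diag x 0 phi_flow) !mxE /=.
  by rewrite !mul1r !mul0r addr0 add0r ab1 sqrtr1.
have cg : {within `[0, T], continuous g}.
  have [C C0 lip] := fundamental_matrix_lipschitz f_smooth phi_flow T_ge0 x_sol.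
  have cW i j : {within `[0, T], continuous (fun t => W t i j)}.
    by apply: (within_continuous_lipschitz C0) => s t *; exact: lip.
  have clin i : {within `[0, T],
    continuous (fun t => (W t i 0 * v 0 0 + W t i 1 * v 1 0) ^+ 2)}.
    by move=> t; apply: cvgM; apply: cvgD; apply: cvgMl; exact: cW.
  move=> t; apply: continuous_comp; last exact: sqrt_continuous.
  by apply: cvgD; exact: clin.
have sigma_onto s : 1 <= s <= sigma T -> exists2 t, 0 <= t <= T & sigma t = s.
  move=> /andP[s1 sT]; have [|t] := IVT T_ge0 cg (v := s).
    by rewrite g0 (gE _ TT) min_l ?max_r ?sigma_ge1// s1 sT.
  by rewrite in_itv/= => tT; rewrite gE// => st; exists t.
pose r := eps / Num.sqrt 2.
have r_gt0 : 0 < r by rewrite divr_gt0// sqrtr_gt0.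
have epsE : eps ^+ 2 = 2 * r ^+ 2.
  by rewrite /r expr_div_n sqr_sqrtr//; field.
rewrite -(area_ellipse_union r_gt0 eps_gt0 epsE (sigma_ge1 _ TT)).
(* Passing to coordinates along [v] and its quarter turn is a rotation, so the area is unchanged. *)
have detV : v 0 0 * v 0 0 - v 1 0 * - v 1 0 = 1 by rewrite -ab1; ring.
rewrite -(area_SL2 detV (measurable_ellipse_union r_gt0 (sigma_ge1 _ TT))).
rewrite /vol; congr ((_ \x _)%E _); apply/seteqP; rewrite /stretched_union.
have memE (t : R) (p : R * R) : 0 <= t <= T ->
  [set invmx (W t) *m u | u in eball eps]
    (\col_(i < 2) (if i == 0 then p.1 else p.2)) <->
  sigma t ^+ 2 * (v 0 0 * p.1 + v 1 0 * p.2) ^+ 2 +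
    (- v 1 0 * p.1 + v 0 0 * p.2) ^+ 2 / sigma t ^+ 2 <= 2 * r ^+ 2.
  move=> tT; have := right_singular_vector_form
    (\col_(i < 2) (if i == 0 then p.1 else p.2)) (detW _ tT) (v_right _ tT).
  rewrite !mxE/= => <-;
    rewrite -epsE ler_pXn2r// ?nnegrE ?sqrtr_ge0 ?(ltW eps_gt0)//.
  exact/mem_stretched_image/detW.
(* One inclusion uses the bounds [1 <= sigma t <= sigma T], the other that every stretch between
   them is attained. *)
split=> p /=.
  move=> [t]; rewrite /= in_itv/= => tT /(memE _ _ tT) Hp.
  by exists (sigma t) => //; rewrite sigma_ge1// sigma_max.
move=> [s /sigma_onto [t tT <-] Hp]; exists t; first by rewrite /= in_itv.
by apply/memE.
Qed.
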